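(* Let $X$ be a Banach space. Assume that there exist normalized weakly null basic sequences $(x_i)$, $(z_i)$ in $X$ such that $(x_i)$ has a spreading model $(\tilde x_i)$ which is not equivalent to the unit vector basis of $\ell_1$, and $(z_i)$ has a spreading model $(\tilde z_i)$ such that $1$ belongs to the Krivine set of $(\tilde z_i)$. Then there exist a (closed) subspace $Y$ of $X$ and a bounded linear operator $T:Y\to X$ which is not a compact perturbation of a multiple of the inclusion map (that is, $T-\lambda I$ is not compact for any scalar $\lambda$, where $I:Y\to X$ is the inclusion).
   Context: Banach spaces are real. A seminormalized sequence $(x_i)$ in a Banach space has (generates) the spreading model $(\tilde x_i)$, where $(\tilde x_i)$ is a basic sequence in some Banach space, if for some sequence $\varepsilon_n\searrow 0$ one has, for all $n\in\mathbb{N}$, all $(a_i)_{i=1}^n\in[-1,1]^n$ and all integers $n\le k_1<\dots<k_n$, $$\left|\Big\|\sum_{i=1}^n a_i x_{k_i}\Big\|-\Big\|\sum_{i=1}^n a_i\tilde x_i\Big\|\right|<\varepsilon_n .$$ The Krivine set of a 1-subsymmetric basic sequence $(x_i)$ (as every spreading model of a weakly null sequence is) is the set of all $p\in[1,\infty]$ such that for all $\varepsilon>0$ and $n\in\mathbb{N}$ there exist $m\in\mathbb{N}$ and $(\lambda_k)_{k=1}^m\subset\mathbb{R}$ such that for all $(a_i)_{i=1}^n\subset\mathbb{R}$ $$\frac1{1+\varepsilon}\|(a_i)_{i=1}^n\|_p\le\Big\|\sum_{i=1}^na_iy_i\Big\|\le(1+\varepsilon)\|(a_i)_{i=1}^n\|_p,\qquad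 y_i=\sum_{k=1}^m\lambda_kx_{(i-1)m+k}\ (i=1,\dots,n),$$ where $\|\cdot\|_p$ is the $\ell_p$ norm. *)

(* Defs.v *)
From HB Require Import structures.
From mathcomp Require Import all_boot all_order all_algebra.
From mathcomp Require Import boolp classical_sets functions reals ereal.
From mathcomp Require Import topology normedtype sequences exp.
Set Implicit Arguments.
Unset Strict Implicit.
Unset Printing Implicit Defensive.
Import Order.TTheory GRing.Theory Num.Theory numFieldNormedType.Exports.
Local Open Scope classical_set_scope.
Local Open Scope ring_scope.

(* Sequences are indexed by nat starting at 0: the term written x_i, i >= 1,
   in the usual notation is [x i.-1].  The index conventions in
   [spreading_model] and [krivine_set] take this shift into account. *)

Definition normalized {R : realType} {V : normedModType R} (x : nat -> V) :=
  forall i, `|x i| = 1.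

Definition seminormalized {R : realType} {V : normedModType R}
    (x : nat -> V) :=
  exists c C : R, 0 < c /\ forall i, c <= `|x i| <= C.

Definition weakly_null {R : realType} {V : normedModType R} (x : nat -> V) :=
  forall f : {scalar V}, continuous f -> f (x n) @[n --> \oo] --> (0 : R).

Definition seq_span {R : realType} {V : normedModType R} (x : nat -> V) :
    set V :=
  [set y | exists (n : nat) (a : nat -> R), y = \sum_(i < n) a i *: x i].

(* x is a Schauder basis of its closed linear span *)
Definition basic_sequence {R : realType} {V : normedModType R}
    (x : nat -> V) :=
  forall y, closure (seq_span x) y ->
    exists! a : nat -> R, series (fun i => a i *: x i) @ \oo --> y.

(* The length n of the tuple determines both the range of the sum and the
   error eps n; since k is increasing, bounding every k i from below is the
   same as bounding the first one. *)
Definition spreading_model {R : realType} {V W : completeNormedModType R}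
    (x : nat -> V) (xt : nat -> W) :=
  [/\ seminormalized x, basic_sequence xt &
    exists eps : nat -> R,
      [/\ nonincreasing_seq eps, eps @ \oo --> (0 : R) &
        forall (n : nat) (a : 'I_n -> R) (k : 'I_n -> nat),
          (0 < n)%N ->
          (forall i, `|a i| <= 1) ->
          (forall i, (n <= (k i).+1)%N) ->
          (forall i j : 'I_n, (i < j)%N -> (k i < k j)%N) ->
          `| `|\sum_(i < n) a i *: x (k i)|
             - `|\sum_(i < n) a i *: xt i| | < eps n]].

(* Only meaningful for 1 <= p <= +oo; the value at -oo is junk. *)
Definition lp_norm {R : realType} (p : \bar R) (n : nat) (a : 'I_n -> R) : R :=
  match p with
  | p%:E => (\sum_(i < n) `|a i| `^ p) `^ p^-1
  | +oo%E => \big[Num.max/0]_(i < n) `|a i|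
  | -oo%E => 0
  end.

(* Equivalence of x with the unit vector basis (e_i) of l_p (c_0 if p = +oo),
   the norm of \sum_i a_i e_i being the l_p norm of (a_i). *)
Definition equivalent_lp_basis {R : realType} {V : normedModType R}
    (p : \bar R) (x : nat -> V) :=
  exists c C : R, 0 < c /\
    forall (n : nat) (a : 'I_n -> R),
      c * lp_norm p a <= `|\sum_(i < n) a i *: x i| <= C * lp_norm p a.

Definition krivine_set {R : realType} {V : normedModType R} (x : nat -> V) :
    set (\bar R) :=
  [set p | (1 <= p)%E /\
    forall (eps : R) (n : nat), 0 < eps ->
      exists (m : nat) (lambda : 'I_m -> R),
        let y i := \sum_(k < m) lambda k *: x (i * m + k)%N in
        forall a : 'I_n -> R,
          (1 + eps)^-1 * lp_norm p a <= `|\sum_(i < n) a i *: y i|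
            <= (1 + eps) * lp_norm p a].

Definition closed_subspace {R : realType} {V : normedModType R} (Y : set V) :=
  closed Y /\ GRing.submod_closed [in Y].

(* An operator from a subspace Y of V to W is represented by a function on V
   whose values outside Y are irrelevant. *)
Definition bounded_linear_on {R : realType} {V W : normedModType R}
    (Y : set V) (T : V -> W) :=
  (forall (a : R) (u v : V), Y u -> Y v -> T (a *: u + v) = a *: T u + T v) /\
  (exists M : R, forall y, Y y -> `|T y| <= M * `|y|).

Definition compact_operator_on {R : realType} {V W : normedModType R}
    (Y : set V) (T : V -> W) :=
  precompact (T @` [set y | Y y /\ `|y| <= 1]).

(* Main.v *)
Require Import Defs.
From HB Require Import structures.
From mathcomp Require Import all_boot all_order all_algebra.
From mathcomp Require Import boolp classical_sets functions reals ereal.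
From mathcomp Require Import topology normedtype sequences exp.
From mathcomp Require Import ring lra zify.
Set Implicit Arguments.
Unset Strict Implicit.
Unset Printing Implicit Defensive.
Import Order.TTheory GRing.Theory Num.Theory numFieldNormedType.Exports.
Local Open Scope classical_set_scope.
Local Open Scope ring_scope.

(** The operator to be built maps a bounded sequence u onto a sparse subsequence
of x.  What has to be arranged is that u dominates every shift of that
subsequence:
<<  | sum_i a_i x_(p (i + r)) | <= C | sum_i a_i u_i |  for all r and a.  >>
Then u_i |-> x_(p i) and u_i |-> x_(p (i + 1)) extend to bounded operators T
and T' on the closed span Y of u ([extend_operator]), and one of them is as
required.  Indeed, if T - l I and T' - l' I were both compact, choose
(mu, mu') <> 0 with mu l + mu' l' = 0: the combination
mu (T - l I) + mu' (T' - l' I) = mu T + mu' T' would be compact too, but it maps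
u_i to mu x_(p i) + mu' x_(p (i + 1)), and these vectors are uniformly
separated, because the terms of a spreading model are linearly independent
([spreading_separated], [not_both_compact]).

Domination compares two estimates.

From above: the spreading model of x is unconditional since x is weakly null,
and averaging a combination of small norm compared with its l_1 norm over its
translates shows that sums of q far-out terms have norm o(q)
([not_l1_small_blocks]).  Grouping the terms by decreasing size of their
coefficients gives, for every eta > 0 and all far-out sums,
| sum a_i x_i | <= eta sum |a_i| + Q max |a_i|, where Q depends on eta only
([small_sum]).

From below: 1 is in the Krivine set of the spreading model of z, so for each N
there is a weakly null sequence any N of whose terms are equivalent to the
basis of l_1^N, with constants that do not depend on N ([krivine_row]). Let u_i
be the sum, over m <= i, of 2^-m times a term of the sequence obtained for N =
N_m. If the coordinates of u could be isolated, one would have sum_(i in I)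
|a_i| <= D_n | sum_i a_i u_i | for any set I of at most N_n indices i >= n.
This does hold ([l1_coordinates_sequence]), with constants D_n that do not
depend on the choice of the numbers N_n. So eta may be taken small compared
with 1 / D_n, and N_n chosen last, large enough for the coefficients to be cut
into levels on each of which the two estimates match ([level_sum_le]).

Isolating coordinates is a form of Schreier unconditionality
([schreier_selection]). A system of requirements on a functional of norm at
most 1 (to take the value 1/2 or -1/2 on certain terms and to be close to 0 on
the others) is represented by a cone of pairs (v, r), to be read as: f v >= r.
It can be fulfilled if and only if r <= |v| for all these pairs, which is a
statement on norms only. The terms are chosen one by one along a free
ultrafilter, while keeping every system with a bounded number of prescribed
signs solvable for almost all choices of the terms still to come. The key step
[ultra_drop] says that the requirement to be small on a term can be added for
almost every term: otherwise the counterexamples for many terms could be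
averaged with weights provided by Mazur's theorem, and would contradict the
solvability of the original system. Mazur's theorem ([mazur]) is itself derived
from the Hahn-Banach theorem for such cones ([consistent_functional]). *)

(** * Finite sums *)

Lemma sum_widen (R : realType) (V : lmodType R) (t : nat -> R) (e : nat -> V)
    m n : (m <= n)%N ->
  \sum_(i < m) t i *: e i =
  \sum_(i < n) (if (i < m)%N then t i else 0) *: e i.
Proof.
move=> mn; rewrite (big_ord_widen n (fun i => t i *: e i) mn) big_mkcond /=.
by apply: eq_bigr => i _; case: ifP => // _; rewrite scale0r.
Qed.

Lemma sum_delta (R : realType) (V : lmodType R) (g : nat -> V) n :
  \sum_(i < n.+1) (i == n :> nat)%:R *: g i = g n.
Proof.
rewrite big_ord_recr /= eqxx scale1r big1 ?add0r// => i _.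
by rewrite (ltn_eqF (ltn_ord i)) scale0r.
Qed.

Lemma sum_lincomb (R : realType) (t : R) (a c : nat -> R) m n :
  exists b : nat -> R, forall (V : lmodType R) (g : nat -> V),
    t *: (\sum_(i < m) a i *: g i) + \sum_(i < n) c i *: g i =
    \sum_(i < maxn m n) b i *: g i.
Proof.
exists (fun i => t * (if (i < m)%N then a i else 0) +
                 (if (i < n)%N then c i else 0)) => V g.
rewrite (sum_widen a g (leq_maxl m n)) (sum_widen c g (leq_maxr m n)).
rewrite scaler_sumr -big_split; apply: eq_bigr => i _.
by rewrite scalerDl scalerA.
Qed.

Lemma sum_flatten (V : nmodType) n m (F : nat -> V) :
  \sum_(h < n * m) F h = \sum_(i < n) \sum_(k < m) F (i * m + k)%N.
Proof.
elim: n => [|n IH]; first by rewrite !big_ord0.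
by rewrite mulSnr big_split_ord /= IH big_ord_recr.
Qed.

Lemma sum_filterC (V : nmodType) (P : pred nat) (s : seq nat) (G : nat -> V) :
  \sum_(i <- s) G i =
  \sum_(i <- [seq i <- s | P i]) G i + \sum_(i <- [seq i <- s | ~~ P i]) G i.
Proof. by rewrite (bigID P) /= !big_filter. Qed.

Lemma sum_half_pow (R : realType) n : \sum_(i < n) (2^-1 : R) ^+ i <= 2.
Proof.
suff -> : \sum_(i < n) (2^-1 : R) ^+ i = 2 - 2 * 2^-1 ^+ n.
  by rewrite gerBl mulr_ge0// exprn_ge0// invr_ge0.
elim: n => [|n IH]; first by rewrite big_ord0 expr0 mulr1 subrr.
by rewrite big_ord_recr /= IH exprS; lra.
Qed.

Lemma normalized_sum_le (R : realType) (X : normedModType R) (x : nat -> X)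
    (p : nat -> nat) (s : seq nat) (a : nat -> R) (n : nat) (M : R) :
  normalized x -> (size s <= n)%N -> 0 <= M -> {in s, forall i, `|a i| <= M} ->
  `|\sum_(i <- s) a i *: x (p i)| <= n%:R * M.
Proof.
move=> nx sn M0 aM; apply: (@le_trans _ _ ((size s)%:R * M)).
  elim: s aM {sn} => [|i s IH] aM; first by rewrite big_nil normr0 mul0r.
  rewrite big_cons /= -natr1 mulrDl mul1r addrC.
  apply: (le_trans (ler_normD _ _)); apply: lerD.
    by apply: IH => j js; apply: aM; rewrite inE js orbT.
  by rewrite normrZ nx mulr1 aM// mem_head.
by rewrite ler_wpM2r// ler_nat.
Qed.

(** * Cones of requirements and the Hahn-Banach theorem *)

(** A set of pairs (v, r) stands for the system of requirements f v >= r on a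
functional f. The consequences of a system that follow by adding and by scaling
form a cone. *)
Definition convex_cone {R : realType} {V : normedModType R}
    (S : set (V * R)) :=
  [/\ S (0, 0),
      forall v r v' r', S (v, r) -> S (v', r') -> S (v + v', r + r') &
      forall t v r, 0 <= t -> S (v, r) -> S (t *: v, t * r)].

(** For a cone, this is equivalent to solvability by a functional of norm at
most 1: see [consistent_functional]. *)
Definition consistent {R : realType} {V : normedModType R}
    (S : set (V * R)) :=
  forall v r, S (v, r) -> r <= `|v|.

(** The requirement that f e be within d of c, tested on the multiples of e. *)
Definition adjoin {R : realType} {V : normedModType R}
    (S : set (V * R)) (e : V) (c d : R) : set (V * R) :=
  [set p | exists v r b,
    [/\ S (v, r), p.1 = v + b *: e & p.2 <= r + c * b - d * `|b|]].

Lemma adjoin_cone (R : realType) (V : normedModType R) (S : set (V * R)) e c d :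
  0 <= d -> convex_cone S -> convex_cone (adjoin S e c d).
Proof.
move=> d0 [S0 SD SZ]; split.
- by exists 0, 0, 0; split=> //=; rewrite ?scale0r ?addr0 ?normr0//; lra.
- move=> w s w' s' [v [r [b [Svr /= -> h]]]] [v' [r' [b' [Svr' /= -> h']]]].
  exists (v + v'), (r + r'), (b + b'); split=> /=; first exact: SD.
    by rewrite scalerDl addrACA.
  have := ler_wpM2l d0 (ler_normD b b'); rewrite mulrDr mulrDr; lra.
- move=> t w s t0 [v [r [b [Svr /= -> h]]]].
  exists (t *: v), (t * r), (t * b); split=> /=; first exact: SZ.
    by rewrite scalerDr scalerA.
  rewrite normrM (ger0_norm t0).
  by have := ler_wpM2l t0 h; rewrite mulrBr mulrDr; lra.
Qed.

Lemma sub_adjoin (R : realType) (V : normedModType R) (S : set (V * R)) e c d :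
  S `<=` adjoin S e c d.
Proof.
move=> [v r] Svr; exists v, r, 0; split=> //=; first by rewrite scale0r addr0.
by rewrite normr0; lra.
Qed.

Lemma adjoin_mem (R : realType) (V : normedModType R) (S : set (V * R)) e c d b :
  S (0, 0) -> adjoin S e c d (b *: e, c * b - d * `|b|).
Proof. by move=> S0; exists 0, 0, b; split=> //=; rewrite ?add0r//; lra. Qed.

Lemma adjoinC (R : realType) (V : normedModType R) (S : set (V * R)) e c d e' c' d' :
  adjoin (adjoin S e c d) e' c' d' = adjoin (adjoin S e' c' d') e c d.
Proof.
suff H : forall (S : set (V * R)) e c d e' c' d',
    adjoin (adjoin S e c d) e' c' d' `<=` adjoin (adjoin S e' c' d') e c d.
  by apply/seteqP; split; exact: H.
move=> {}S {}e {}c {}d {}e' {}c' {}d' [w s].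
move=> [_ [r1 [b' [[v [r [b [Svr /= -> h]]]] /= -> h']]]].
exists (v + b' *: e'), (r + c' * b' - d' * `|b'|), b; split=> /=.
- by exists v, r, b'.
- by rewrite addrAC.
- lra.
Qed.

(** One extension step of Hahn-Banach. Subadditivity of the norm separates the
lower bounds r - |v - e| for f e from the upper bounds |v + e| - r, so that c
can be taken to be the supremum of the former. *)
Lemma consistent_adjoin (R : realType) (V : normedModType R) (S : set (V * R)) e :
  convex_cone S -> consistent S -> exists c, consistent (adjoin S e c 0).
Proof.
move=> [S0 SD SZ] Sc.
pose L := [set x | exists v r, S (v, r) /\ x = r - `|v - e|].
have L0 : L !=set0 by exists (0 - `|0 - e|), 0, 0.
have Lub v r : S (v, r) -> ubound L (`|v + e| - r).
  move=> Svr _ [v' [r' [Svr' ->]]].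
  have := Sc _ _ (SD _ _ _ _ Svr Svr').
  have := ler_normD (v + e) (v' - e).
  by rewrite addrACA subrr addr0; lra.
pose c := sup L; exists c.
have cU v r : S (v, r) -> c <= `|v + e| - r by move=> /Lub; exact: ge_sup.
have cL v r : S (v, r) -> r - `|v - e| <= c.
  move=> Svr; apply: sup_ubound; last by exists v, r.
  by exists (`|0 + e| - 0); exact: Lub.
move=> w s [v [r [b [Svr /= -> h]]]].
have [b0|b0|b0] := ltgtP b 0.
- have nb : 0 < - b by lra.
  have := cL _ _ (SZ _ _ _ (ltW (eqbRL (invr_gt0 _) nb)) Svr).
  have -> : v + b *: e = (- b) *: ((- b)^-1 *: v - e).
    by rewrite scalerBr scalerA mulfV ?lt0r_neq0// scale1r scaleNr opprK.
  rewrite normrZ (gtr0_norm nb) => /(ler_wpM2l (ltW nb)).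
  by rewrite mulrBr mulrA mulfV ?lt0r_neq0// mul1r; lra.
- have := cU _ _ (SZ _ _ _ (ltW (eqbRL (invr_gt0 _) b0)) Svr).
  have -> : v + b *: e = b *: (b^-1 *: v + e).
    by rewrite scalerDr scalerA mulfV ?lt0r_neq0// scale1r.
  rewrite normrZ (gtr0_norm b0) => /(ler_wpM2l (ltW b0)).
  by rewrite mulrBr mulrA mulfV ?lt0r_neq0// mul1r; lra.
- by rewrite b0 scale0r addr0; have := Sc _ _ Svr; move: h; rewrite b0 normr0;
  lra.
Qed.

(** Hahn-Banach: a maximal consistent cone prescribes the value of f at each
vector exactly, by [consistent_adjoin], so it is the hypograph of a linear
functional. *)
Lemma consistent_functional (R : realType) (V : normedModType R)
    (S : set (V * R)) :
  convex_cone S -> consistent S ->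
  exists f : {scalar V},
    (forall v, `|f v| <= `|v|) /\ (forall v r, S (v, r) -> r <= f v).
Proof.
move=> cS kS.
(* The empty set is allowed since Zorn's lemma for unions is also applied to
   the empty chain. *)
pose P := [set A : set (V * R) |
  A = set0 \/ [/\ convex_cone A, consistent A & S `<=` A]].
have [F FP Ftot|A [PA Amax]] := @Zorn_bigcup _ P.
  have [[A0 FA0 [a A0a]]|F0] := pselect (exists2 A0, F A0 & A0 !=set0);
    last first.
    left; apply/seteqP; split=> // p [B FB Bp]; exfalso.
    by apply: F0; exists B => //; exists p.
  have FP' B : F B -> B !=set0 -> [/\ convex_cone B, consistent B & S `<=` B].
    by move=> FB [b Bb]; have [B0|//] := FP _ FB; move: Bb; rewrite B0.
  right; have [[A00 AD AZ] kA SA] := FP' _ FA0 (ex_intro _ a A0a); split.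
  - split; first by exists A0.
      move=> v r v' r' [B FB Bv] [B' FB' Bv'].
      have [BB'|B'B] := Ftot _ _ FB FB'.
        have [[_ BD _] _ _] := FP' _ FB' (ex_intro _ _ Bv').
        by exists B' => //; apply: BD => //; exact: BB'.
      have [[_ BD _] _ _] := FP' _ FB (ex_intro _ _ Bv).
      by exists B => //; apply: BD => //; exact: B'B.
    move=> t v r t0 [B FB Bv];
      have [[_ _ BZ] _ _] := FP' _ FB (ex_intro _ _ Bv).
    by exists B => //; exact: BZ.
  - move=> v r [B FB Bv]; have [_ kB _] := FP' _ FB (ex_intro _ _ Bv).
    exact: kB.
  - by move=> p Sp; exists A0 => //; exact: SA.
have {PA} [cA kA SA] : [/\ convex_cone A, consistent A & S `<=` A].
  case: PA => // A0; exfalso.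
  have S00 : S (0, 0) by case: cS.
  apply: (Amax S); last by right; split.
  by rewrite A0; split=> // /(_ _ S00).
have [A00 AD AZ] := cA.
have ext e : exists c, A (e, c) /\ A (- e, - c).
  have [c kc] := consistent_adjoin e cA kA; exists c.
  have AE : adjoin A e c 0 `<=` A.
    apply: contrapT => nAE; apply: (Amax (adjoin A e c 0)); last first.
      right; split=> //; first exact: adjoin_cone.
      exact: (subset_trans SA (@sub_adjoin _ _ _ _ _ _)).
    by split=> //; exact: sub_adjoin.
  split; apply: AE.
    by have := adjoin_mem e c 0 1 A00; rewrite scale1r mulr1 mul0r subr0.
  have := adjoin_mem e c 0 (-1) A00.
  by rewrite scaleN1r mulrN1 mul0r subr0.
have /choice [g gP] := ext.
have guniq v r : A (v, r) -> r <= g v.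
  move=> Av; have := kA _ _ (AD _ _ _ _ Av (gP v).2).
  by rewrite subrr normr0; lra.
have gN v : g (- v) = - g v.
  apply/eqP; rewrite eq_le (guniq _ _ (gP v).2) andbT.
  by have := kA _ _ (AD _ _ _ _ (gP v).1 (gP (- v)).1); rewrite subrr normr0;
    lra.
have gD v w : g (v + w) = g v + g w.
  apply/eqP; rewrite eq_le (guniq _ _ (AD _ _ _ _ (gP v).1 (gP w).1)) andbT.
  have := guniq _ _ (AD _ _ _ _ (gP v).2 (gP w).2).
  by rewrite -(opprD v w) gN; lra.
have gZ0 t v : 0 <= t -> g (t *: v) = t * g v.
  move=> t0; apply/eqP; rewrite eq_le (guniq _ _ (AZ _ _ _ t0 (gP v).1)) andbT.
  have := guniq _ _ (AZ _ _ _ t0 (gP v).2).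
  by rewrite scalerN gN; lra.
have gZ t v : g (t *: v) = t * g v.
  have [t0|t0] := leP 0 t; first exact: gZ0.
  have -> : t *: v = - ((- t) *: v) by rewrite scaleNr opprK.
  by rewrite gN gZ0 ?mulNr ?opprK ?oppr_ge0 ?ltW.
have glin : linear_for *%R g by move=> a u w; rewrite gD gZ.
pose glinM := GRing.isLinear.Build R V R *%R g glin.
pose f : {scalar V} := HB.pack g glinM.
exists f; split=> [v|v r Sv]; last exact/guniq/SA.
rewrite ler_norml; apply/andP; split; last exact/kA/(gP v).1.
by have := kA _ _ (gP v).2; rewrite normrN /=; lra.
Qed.

(** * Convex combinations of weakly null sequences *)

Lemma cone_sum (R : realType) (V : normedModType R) (S : set (V * R))
    n (t : nat -> R) (v : nat -> V) (r : nat -> R) :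
  convex_cone S -> (forall i, 0 <= t i) ->
  (forall i, (i < n)%N -> S (v i, r i)) ->
  S (\sum_(i < n) t i *: v i, \sum_(i < n) t i * r i).
Proof.
move=> [S0 SD SZ] t0; elim: n => [|n IH] Sv; first by rewrite !big_ord0.
rewrite !big_ord_recr /=; apply: SD; first by apply: IH => i /ltnW; exact: Sv.
by apply: SZ => //; exact: Sv.
Qed.

(** Otherwise the cone of the requirements f (e i) >= d for i in P is
consistent, and a functional that fulfils them prevents e from being weakly
null. *)
Lemma mazur (R : realType) (V : normedModType R) (e : nat -> V) (P : set nat)
    (d : R) :
  weakly_null e -> (forall n, exists2 m, (n <= m)%N & P m) -> 0 < d ->
  exists n (t : nat -> R), [/\ forall i, 0 <= t i, forall i, t i != 0 -> P i,
    \sum_(i < n) t i = 1 & `|\sum_(i < n) t i *: e i| < d].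
Proof.
move=> we Pinf d0; apply: contrapT => nex.
pose S := [set p : V * R | exists n (t : nat -> R),
  [/\ forall i, 0 <= t i, forall i, t i != 0 -> P i,
    p.1 = \sum_(i < n) t i *: e i & p.2 = \sum_(i < n) t i *: (d : R^o)]].
have cS : convex_cone S.
  split.
  - by exists 0%N, (fun _ => 0); split=> [i|i||] /=; rewrite ?eqxx ?big_ord0.
  - move=> v r v' r' [n [t [t0 tP /= -> ->]]] [n' [t' [t0' tP' /= -> ->]]].
    exists (maxn n n'), (fun i => (if (i < n)%N then t i else 0) +
                                  (if (i < n')%N then t' i else 0)).
    split=> [i|i||] /=.
    + by apply: addr_ge0; case: ifP.
    + have [t_eq0|/tP//] := eqVneq (t i) 0.
      have [t'_eq0|/tP'//] := eqVneq (t' i) 0.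
      by rewrite t_eq0 t'_eq0 !if_same addr0 eqxx.
    + rewrite (sum_widen t e (leq_maxl n n')) (sum_widen t' e (leq_maxr n n')).
      by rewrite -big_split; apply: eq_bigr => i _; rewrite scalerDl.
    + rewrite (sum_widen t (fun=> d : R^o) (leq_maxl n n')).
      rewrite (sum_widen t' (fun=> d : R^o) (leq_maxr n n')).
      by rewrite -big_split; apply: eq_bigr => i _; rewrite scalerDl.
  - move=> a v r a0 [n [t [t0 tP /= -> ->]]].
    exists n, (fun i => a * t i); split=> [i|i||] /=.
    + exact: mulr_ge0.
    + by rewrite mulf_eq0 negb_or => /andP[_ /tP].
    + by rewrite scaler_sumr; apply: eq_bigr => i _; rewrite scalerA.
    + by rewrite mulr_sumr; apply: eq_bigr => i _; rewrite -scalerA.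
have kS : consistent S.
  move=> v r [n [t [t0 tP /= -> ->]]]; rewrite -scaler_suml.
  set s := \sum_(i < n) t i.
  have s0 : 0 <= s by apply: sumr_ge0.
  have [s_eq0|s_neq0] := eqVneq s 0; first by rewrite s_eq0 scale0r.
  have sp : 0 < s by rewrite lt_neqAle eq_sym s_neq0.
  rewrite leNgt; apply/negP => h; apply: nex.
  exists n, (fun i => s^-1 * t i); split=> [i|i||].
  - by rewrite mulr_ge0// invr_ge0.
  - by rewrite mulf_eq0 negb_or => /andP[_ /tP].
  - by rewrite -mulr_sumr mulVf.
  - under eq_bigr do rewrite -scalerA.
    rewrite -scaler_sumr normrZ gtr0_norm ?invr_gt0//.
    by rewrite mulrC ltr_pdivrMr// mulrC.
have [f [fle fge]] := consistent_functional cS kS.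
have fe m : P m -> d <= f (e m).
  move=> Pm; apply: fge; exists m.+1, (fun i => (i == m)%:R);
    split=> [i|i||] /=.
  - exact: ler0n.
  - by have [->//|_] := eqVneq i m; rewrite eqxx.
  - by rewrite sum_delta.
  - by rewrite (sum_delta (fun=> d : R^o)).
have fc : continuous f.
  move=> v; apply/cvgrPdist_lt => eps eps0; near=> w.
  rewrite -linearB; apply: (le_lt_trans (fle _)).
  by near: w; apply: cvgr_dist_lt.
have /cvgrPdist_lt/(_ d d0) [n _ hn] := we f fc.
have [m nm Pm] := Pinf n.
have := hn m nm; rewrite sub0r normrN => h.
by have := lt_le_trans h (fe m Pm); rewrite ltNge ler_norm.
Unshelve. all: by end_near. Qed.

Lemma ultra_frequent (U : set_system nat) (P : set nat) :
  UltraFilter U -> \oo `<=` U -> U P -> forall n, exists2 m, (n <= m)%N & P m.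
Proof.
move=> UU Uoo UP n.
have [m [nm Pm]] := filter_ex (filterI (Uoo _ (nbhs_infty_ge n)) UP).
by exists m.
Qed.

(** The filter F stands for a random system of requirements. If adding
smallness on e_j failed for most j, then for many j, almost every system S
would contain some (v, r) with | v + s e_j | < r - d, with one and the same
sign s. For finitely many such j and one S that serves them all, averaging with
the weights given by [mazur] cancels the terms s e_j up to an error d and
leaves a pair of S with r > |v|. *)
Lemma ultra_drop (R : realType) (V : normedModType R) (e : nat -> V)
    (U : set_system nat) (F : set_system (set (V * R))) (d : R) :
  UltraFilter U -> \oo `<=` U -> weakly_null e ->
  ProperFilter F -> (forall P, F P \/ F (~` P)) ->
  F (@convex_cone R V) -> F (@consistent R V) -> 0 < d ->
  U [set j | F [set S | consistent (adjoin S (e j) 0 d)]].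
Proof.
move=> UU Uoo we FF Fultra Fc Fk d0.
have [//|UG] := in_ultra_setVsetC
  [set j | F [set S | consistent (adjoin S (e j) 0 d)]] UU; exfalso.
pose bad (s : R) j := [set S : set (V * R) |
  exists v r, S (v, r) /\ `|v + s *: e j| < r - d].
have badP j : ~ F [set S | consistent (adjoin S (e j) 0 d)] ->
    F (bad 1 j) \/ F (bad (-1) j).
  move=> nFj; have {nFj} FCj : F (~` [set S | consistent (adjoin S (e j) 0 d)]).
    by have [|//] := Fultra [set S | consistent (adjoin S (e j) 0 d)].
  apply: contrapT => /not_orP[n1 n2].
  have F1 : F (~` bad 1 j) by have [] := Fultra (bad 1 j).
  have F2 : F (~` bad (-1) j) by have [] := Fultra (bad (-1) j).
  have [S [[[nS1 nS2] nkS] [cS kS]]] := filter_ex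
    (filterI (filterI (filterI F1 F2) FCj) (filterI Fc Fk)).
  apply: nkS => /= w s [v [r [b [Svr /= -> hs]]]].
  rewrite leNgt; apply/negP => hlt.
  have [b_eq0|b_neq0] := eqVneq b 0.
    have := kS _ _ Svr; move: hlt hs.
    by rewrite b_eq0 scale0r addr0 normr0; lra.
  have nb0 : 0 < `|b|^-1 by rewrite invr_gt0 normr_gt0.
  have Sb : bad (Num.sg b) j S.
    exists (`|b|^-1 *: v), (`|b|^-1 * r); split.
      by case: cS => _ _ SZ; apply: SZ => //; exact: ltW.
    have -> : `|b|^-1 *: v + Num.sg b *: e j = `|b|^-1 *: (v + b *: e j).
      rewrite scalerDr scalerA; congr (_ + _ *: _).
      by rewrite {3}[b]numEsg mulrCA mulVf ?mulr1// normr_eq0.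
    rewrite normrZ (gtr0_norm nb0).
    have -> : `|b|^-1 * r - d = `|b|^-1 * (r - d * `|b|).
      by rewrite mulrBr [d * _]mulrC mulKf// normr_eq0.
    by rewrite ltr_pM2l//; apply: (lt_le_trans hlt); move: hs; lra.
  have [b0|b0|b0] := ltgtP b 0; last by rewrite b0 eqxx in b_neq0.
    by apply: nS2; rewrite -(ltr0_sg b0).
  by apply: nS1; rewrite -(gtr0_sg b0).
(* An ultrafilter selects one of the two signs. *)
have [s sN [G GF UGs]] : exists2 s : R, `|s| = 1 &
    exists2 G : set nat, G `<=` (fun j => F (bad s j)) & U G.
  have [U1|U1] := in_ultra_setVsetC [set j | F (bad 1 j)] UU.
    by exists 1; [rewrite normr1|exists [set j | F (bad 1 j)]].
  exists (-1); first by rewrite normrN1.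
  exists (~` [set j | F [set S | consistent (adjoin S (e j) 0 d)]] `&`
          ~` [set j | F (bad 1 j)]); last exact: filterI.
  by move=> j [/badP[]].
have [n [t [t0 tG t1 tn]]] := mazur we (ultra_frequent UU Uoo UGs) d0.
have Fall : F [set S | forall i : 'I_n, G i -> bad s i S].
  apply: (@filter_forall _ _ (fun (i : 'I_n) S => G i -> bad s i S)) => i.
  have [Gi|nGi] := pselect (G i); last by apply: filterE.
  by apply: filterS (GF _ Gi).
have [S [Sbad [cS kS]]] := filter_ex (filterI Fall (filterI Fc Fk)).
have /choice [q qP] : forall i, exists p : V * R, (i < n)%N ->
    S (p.1, p.2) /\ (t i != 0 -> `|p.1 + s *: e i| < p.2 - d).
  move=> i; have [ltin|] := ltnP i n; last by exists (0, 0).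
  have [ti|ti] := eqVneq (t i) 0.
    by exists (0, 0) => _; split=> //; case: cS.
  have [v [r [Svr h]]] := Sbad (Ordinal ltin) (tG _ ti).
  by exists (v, r).
have := kS _ _ (cone_sum cS t0 (fun i hi => (qP i hi).1)).
apply/negP; rewrite -ltNge.
have -> : \sum_(i < n) t i *: (q i).1 =
    \sum_(i < n) t i *: ((q i).1 + s *: e i) - s *: \sum_(i < n) t i *: e i.
  rewrite scaler_sumr -sumrB; apply: eq_bigr => i _.
  by rewrite scalerDr !scalerA [s * _]mulrC addrK.
apply: (le_lt_trans (ler_normB _ _)); rewrite normrZ sN mul1r.
have : `|\sum_(i < n) t i *: ((q i).1 + s *: e i)| <=
    \sum_(i < n) t i * ((q i).2 - d).
  apply: (le_trans (ler_norm_sum _ _ _)); apply: ler_sum => i _.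
  rewrite normrZ ger0_norm//; have [->|ti] := eqVneq (t i) 0.
    by rewrite !mul0r.
  by apply: ler_wpM2l => //; exact/ltW/((qP i (ltn_ord i)).2 ti).
have -> : \sum_(i < n) t i * ((q i).2 - d) = \sum_(i < n) t i * (q i).2 - d.
  under eq_bigr do rewrite mulrBr.
  by rewrite sumrB -mulr_suml t1 mul1r.
lra.
Qed.

(** * Selecting terms with prescribed signs *)

(** The iterated ultrafilter: P holds for almost all j_1, for almost all j_2,
and so on, of the system S enlarged by the requirements f (e j_i) = c_i. The
order of the quantifiers matters: later indices are generic with respect to the
earlier ones. *)
Fixpoint select {R : realType} {V : normedModType R} (U : set_system nat)
    (e : nat -> V) (cs : seq R) (S : set (V * R)) : set_system (set (V * R)) :=
  if cs is c :: cs' then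
    [set P | U [set j | select U e cs' (adjoin S (e j) c 0) P]]
  else [set P | P S].

Section Select.
Context (R : realType) (V : normedModType R) (U : set_system nat).
Context (e : nat -> V) (UU : UltraFilter U).
Implicit Types (S : set (V * R)) (cs : seq R).

Lemma select_filter cs S : ProperFilter (select U e cs S).
Proof.
elim: cs S => [|c cs IH] S /=.
  by split=> //; split=> // P Q PQ; exact: PQ.
split.
  move=> U0; have [j j0] := @filter_ex _ U _ _ U0.
  by have [n0 _] := IH (adjoin S (e j) c 0); exact: n0 j0.
split.
- by apply: (@filterE _ U) => j; exact: (@filterT _ _ (IH _)).
- move=> P Q UP UQ;
  apply: (@filterS _ U _ _ _ _ (@filterI _ U _ _ _ UP UQ)) => j [].
  exact: (@filterI _ _ (IH _)).
- by move=> P Q PQ UP; apply: (@filterS _ U _ _ _ _ UP) => j;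
  exact: (@filterS _ _ (IH _)).
Qed.

Lemma select_ultra cs S P : select U e cs S P \/ select U e cs S (~` P).
Proof.
elim: cs S => [|c cs IH] S /=; first exact: lem.
have [h|h] := in_ultra_setVsetC
  [set j | select U e cs (adjoin S (e j) c 0) P] UU; first by left.
right; apply: filterS h => j nj.
by have [] := IH (adjoin S (e j) c 0).
Qed.

Lemma select_cone cs S : convex_cone S -> select U e cs S (@convex_cone R V).
Proof.
elim: cs S => [|c cs IH] S //= cS.
by apply: filterE => j; apply: IH; exact: adjoin_cone.
Qed.

Lemma select_adjoin cs S v c d P :
  select U e cs (adjoin S v c d) P <->
  select U e cs S [set S' | P (adjoin S' v c d)].
Proof.
elim: cs S => [|c' cs IH] S //=.
have -> // : [set j | select U e cs (adjoin (adjoin S v c d) (e j) c' 0) P] =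
  [set j | select U e cs (adjoin S (e j) c' 0) [set S' | P (adjoin S' v c d)]].
by apply/seteqP; split=> j /=; rewrite adjoinC IH.
Qed.

Lemma select_sub cs S : select U e cs S [set S' | S `<=` S'].
Proof.
elim: cs S => [|c cs IH] S //=; apply: filterE => j.
have := @select_filter cs (adjoin S (e j) c 0) => FF.
apply: filterS (IH _) => S'; apply: subset_trans; exact: sub_adjoin.
Qed.

Lemma select_consistent cs S :
  select U e cs S (@consistent R V) -> consistent S.
Proof.
have FF := @select_filter cs S => h.
have [S' [kS' SS']] := filter_ex (filterI h (select_sub cs S)).
by move=> v r Svr; apply: kS'; exact: SS'.
Qed.

(** A free ultrafilter only sees increasing choices of the indices, so
estimates for increasing indices suffice. *)
Lemma select_lower cs S :
  (forall (s : seq nat) (a : nat -> R) v r,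
    size s = size cs -> sorted ltn s -> S (v, r) ->
    r + \sum_(i < size cs) nth 0 cs i * a i <=
      `|v + \sum_(i < size cs) a i *: e (nth 0%N s i)|) ->
  \oo `<=` U -> select U e cs S (@consistent R V).
Proof.
move=> H Uoo.
suff : forall k, (forall (s : seq nat) (a : nat -> R) v r,
    size s = size cs -> path ltn k s -> S (v, r) ->
    r + \sum_(i < size cs) nth 0 cs i * a i <=
      `|v + \sum_(i < size cs) a i *: e (nth 0%N s i)|) ->
   select U e cs S (@consistent R V).
  by move=> /(_ 0%N); apply=> s a v r ss /path_sorted; exact: H.
elim: cs S {H} => [|c cs IH] S k H /=.
  move=> v r Svr; have := H [::] (fun=> 0) _ _ erefl isT Svr.
  by rewrite !big_ord0 !addr0.
apply: filterS (Uoo _ (nbhs_infty_gt k)) => j kj.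
apply: (IH _ j) => s a w r' ss ps [v [r [b' [Svr /= -> hr]]]].
pose a' i := if i is i'.+1 then a i' else b'.
have := H (j :: s) a' v r; rewrite /= ss kj => /(_ erefl ps Svr).
rewrite !big_ord_recl /= addrA -[v + _ + _]addrA.
by move: hr; lra.
Qed.

End Select.

Definition half_sign {R : realType} (b : bool) : R := (-1) ^+ b / 2.

(** The requirements on the terms chosen at the times n <= t < T, following a
pattern p: the value is a prescribed half sign where p gives one, and is within
d t of 0 elsewhere. Times before n impose nothing: only finitely many values of
n then have to be considered at each time. *)
Fixpoint pattern_cone {R : realType} {V : normedModType R}
    (w : nat -> nat -> V) (row : nat -> nat) (d : nat -> R)
    (n : nat) (l : nat -> nat) (p : nat -> option bool) (T : nat)
    : set (V * R) :=
  if T is t.+1 then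
    let S := pattern_cone w row d n l p t in
    if (t < n)%N then S else
    if p t is Some b then adjoin S (w (row t) (l t)) (half_sign b) 0
    else adjoin S (w (row t) (l t)) 0 (d t)
  else [set (0, 0)].

Lemma dependent_selection (P : nat -> (nat -> nat) -> Prop) :
  (forall T l l', (forall t, (t < T)%N -> l t = l' t) -> P T l -> P T l') ->
  P 0%N (fun=> 0%N) ->
  (forall T l, P T l ->
     exists j, P T.+1 (fun t => if (t < T)%N then l t else j)) ->
  exists l, forall T, P T l.
Proof.
move=> Pext P0 PS.
have /choice [g gP] : forall q : nat * (nat -> nat), exists j,
    P q.1 q.2 -> P q.1.+1 (fun t => if (t < q.1)%N then q.2 t else j).
  move=> [T l] /=; have [/PS[j hj]|nP] := pselect (P T l); first by exists j.
  by exists 0%N.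
pose fix L T : nat -> nat := if T is t.+1
  then (fun i => if (i < t)%N then L t i else g (t, L t)) else (fun=> 0%N).
have PL T : P T (L T) by elim: T => // T IH; exact: (gP (T, L T) IH).
have LE T t : (t < T)%N -> L T t = L t.+1 t.
  elim: T => // T IH; rewrite ltnS leq_eqVlt => /orP[/eqP -> //|tT].
  by rewrite -IH// [LHS]/= tT.
exists (fun t => L t.+1 t) => T.
by apply: Pext (PL T) => t; exact: LE.
Qed.

Section Selection.
Context (R : realType) (V : normedModType R) (w : nat -> nat -> V).
Context (row N : nat -> nat) (d : nat -> R).
Hypothesis w_null : forall m, weakly_null (w m).
Hypothesis d_gt0 : forall t, 0 < d t.
Hypothesis w_l1 : forall m (s : seq nat) (a : nat -> R),
  size s = N m -> sorted ltn s ->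
  2^-1 * \sum_(i < N m) `|a i| <= `|\sum_(i < N m) a i *: w m (nth 0%N s i)|.

Lemma pattern_cone_ext n l p T l' p' :
  (forall t, (t < T)%N -> l t = l' t /\ p t = p' t) ->
  pattern_cone w row d n l p T = pattern_cone w row d n l' p' T.
Proof.
elim: T => [//|T IH] H /=; rewrite IH; last by move=> t tT; exact/H/ltnW.
by have [-> ->] := H T (ltnSn T).
Qed.

Lemma pattern_cone_cone n l p T : convex_cone (pattern_cone w row d n l p T).
Proof.
elim: T => [|T IH] /=.
  split=> // [v r v' r' [-> ->] [-> ->]|t v r _ [-> ->]].
    by rewrite !addr0.
  by rewrite scaler0 mulr0.
case: ifP => // _; case: (p T) => [b|]; first exact: adjoin_cone.
by apply: adjoin_cone => //; exact: ltW.
Qed.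

Lemma pattern_cone_lt n l p T :
  (T <= n)%N -> pattern_cone w row d n l p T = [set (0, 0)].
Proof. by elim: T => //= T IH Tn; rewrite Tn IH// ltnW. Qed.

Definition picks (p : nat -> option bool) (T : nat) :=
  count (fun t => isSome (p t)) (iota 0 T).

Lemma picksS p T : picks p T.+1 = (picks p T + isSome (p T))%N.
Proof. by rewrite /picks -addn1 iotaD count_cat /= addn0. Qed.

(** The invariant of the construction: after T choices, every pattern that
starts at some n <= T and has its signs on terms of the row n can be completed
to N n signs, the remaining ones sg being arbitrary, by almost all further
choices in that row. *)
Definition extendable (U : set_system nat) (T : nat) (l : nat -> nat) :=
  forall n (p : nat -> option bool) (sg : seq bool),
    (n <= T)%N ->
    (forall t, (t < T)%N -> isSome (p t) -> (n <= t)%N /\ row t = n) ->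
    (picks p T + size sg = N n)%N ->
    select U (w n) (map half_sign sg) (pattern_cone w row d n l p T)
      (@consistent R V).

Lemma extendable_start (U : set_system nat) n l p T sg :
  UltraFilter U -> \oo `<=` U -> (T <= n)%N -> size sg = N n ->
  select U (w n) (map half_sign sg) (pattern_cone w row d n l p T)
      (@consistent R V).
Proof.
move=> UU Uoo Tn sN; rewrite pattern_cone_lt//.
apply: select_lower => // s a v r; rewrite size_map sN => ss so [-> ->].
rewrite !add0r; apply: le_trans (w_l1 a ss so).
rewrite mulr_sumr; apply: ler_sum => i _.
rewrite (nth_map false) ?sN// /half_sign mulrAC mulrC ler_pM2l ?invr_gt0//.
by apply: (le_trans (ler_norm _)); rewrite normrM normrX normrN1 expr1n mul1r.
Qed.

(** At time T, almost every index j can be used in both roles: as a term with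
the next sign, by definition of the iterated ultrafilter, or as a term on which
the functional is small, by [ultra_drop]. There are only finitely many patterns
to consider, hence a common j. *)
Lemma extendable_step (U : set_system nat) T l :
  UltraFilter U -> \oo `<=` U -> extendable U T l ->
  exists j, extendable U T.+1 (fun t => if (t < T)%N then l t else j).
Proof.
move=> UU Uoo ext.
pose p_ (s : T.-tuple (option bool)) := fun t => nth None s t.
pose Q n p sg j :=
  select U (w n) (map half_sign sg)
    (adjoin (pattern_cone w row d n l p T) (w (row T) j) 0 (d T))
    (@consistent R V) /\
  (row T = n -> forall b sg', sg = b :: sg' ->
    select U (w n) (map half_sign sg')
      (adjoin (pattern_cone w row d n l p T) (w n j) (half_sign b) 0)
      (@consistent R V)).
have step n p sg : (n <= T)%N ->
    (forall t, (t < T)%N -> isSome (p t) -> (n <= t)%N /\ row t = n) ->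
    (picks p T + size sg = N n)%N -> U [set j | Q n p sg j].
  move=> nT adm pN; have sel := ext n p sg nT adm pN; apply: filterI.
    have FF := @select_filter _ _ U (w n) UU (map half_sign sg)
      (pattern_cone w row d n l p T).
    have := ultra_drop UU Uoo (w_null (row T)) FF (@select_ultra _ _ _ _ UU _ _)
      (@select_cone _ _ _ _ UU _ _ (pattern_cone_cone n l p T)) sel (d_gt0 T).
    by apply: filterS => j; rewrite /= select_adjoin.
  case: sg sel {pN} => [|b sg] /= sel; first by apply: filterE => j.
  by apply: filterS sel => j h _ b' sg' [<- <-].
have allstep : U [set j | forall (n : 'I_T.+1) (s : T.-tuple (option bool))
    (sg : (N n - picks (p_ s) T).-tuple bool),
    (forall t, (t < T)%N -> isSome (p_ s t) -> (n <= t)%N /\ row t = n) ->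
    (picks (p_ s) T + size sg = N n)%N -> Q n (p_ s) sg j].
  apply: (@filter_forall _ _ (fun (n : 'I_T.+1) j => forall
    (s : T.-tuple (option bool)) (sg : (N n - picks (p_ s) T).-tuple bool),
    (forall t, (t < T)%N -> isSome (p_ s t) -> (n <= t)%N /\ row t = n) ->
    (picks (p_ s) T + size sg = N n)%N -> Q n (p_ s) sg j)) => n.
  apply: (@filter_forall _ _ (fun (s : T.-tuple (option bool)) j => forall
    (sg : (N n - picks (p_ s) T).-tuple bool),
    (forall t, (t < T)%N -> isSome (p_ s t) -> (n <= t)%N /\ row t = n) ->
    (picks (p_ s) T + size sg = N n)%N -> Q n (p_ s) sg j)) => s.
  apply: (@filter_forall _ _
    (fun (sg : (N n - picks (p_ s) T).-tuple bool) j =>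
    (forall t, (t < T)%N -> isSome (p_ s t) -> (n <= t)%N /\ row t = n) ->
    (picks (p_ s) T + size sg = N n)%N -> Q n (p_ s) sg j)) => sg.
  have [adm|nadm] := pselect (forall t, (t < T)%N -> isSome (p_ s t) ->
    (n <= t)%N /\ row t = n); last by apply: filterE.
  have [pN|npN] := pselect (picks (p_ s) T + size sg = N n)%N; last first.
    by apply: filterE.
  by apply: filterS (step n (p_ s) sg (ltn_ord n) adm pN).
have [j jP] := filter_ex allstep; exists j => n p sg nT adm pN.
have [nT'|] := leqP n T; last first.
  move=> Tn; have {Tn nT} nE : n = T.+1 by apply/eqP; rewrite eqn_leq nT.
  apply: extendable_start => //; first by rewrite nE.
  rewrite -pN /picks;
    have -> // : count (fun t => isSome (p t)) (iota 0 T.+1) = 0%N.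
  apply/eqP; rewrite -leqn0 leqNgt -has_count; apply/hasPn => t.
  rewrite mem_iota add0n /= => tT; apply/negP => /(adm _ tT)[].
  by rewrite nE ltnNge -ltnS tT.
have sT : size (mkseq p T) == T by rewrite size_mkseq.
pose s : T.-tuple (option bool) := Tuple sT.
have psE t : (t < T)%N -> p_ s t = p t by move=> tT; rewrite /p_ nth_mkseq.
have picksE : picks (p_ s) T = picks p T.
  by apply: eq_in_count => t; rewrite mem_iota add0n => tT; rewrite psE.
have adm' t : (t < T)%N -> isSome (p_ s t) -> (n <= t)%N /\ row t = n.
  by move=> tT; rewrite psE// => /adm; apply; exact: ltnW.
have QE sg' : (picks p T + size sg' = N n)%N -> Q n p sg' j.
  move=> pN'.
  have szs : size sg' == (N n - picks (p_ s) T)%N.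
    by rewrite picksE -pN' addKn.
  have := jP (Ordinal (nT' : (n < T.+1)%N)) s (Tuple szs) adm'.
  move=> /(_ (etrans (congr1 (addn^~ _) picksE) pN')); rewrite /Q /=.
  by rewrite (@pattern_cone_ext n l (p_ s) T l p)// => t tT; rewrite psE.
rewrite /= ltnNge nT' /= ltnn (@pattern_cone_ext n _ p T l p); last first.
  by move=> t tT; rewrite tT.
move: pN; rewrite picksS; case pT: (p T) => [b|] /=.
  rewrite addnAC -addnA addn1 => pN.
  have [_ rT] := adm T (ltnSn T) (introT idP (etrans (congr1 isSome pT) erefl)).
  have [_ /(_ rT b sg erefl)] := QE (b :: sg) pN.
  by rewrite rT.
by rewrite addn0 => /QE[].
Qed.

(** The signs of the coefficients a t, t in A, form one of the patterns; the
inequality is its consistency, tested on the combination of the chosen terms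
with coefficients a. *)
Lemma schreier_selection :
  exists l : nat -> nat, forall n T (A : pred nat) (a : nat -> R),
    (forall t, (t < T)%N -> A t -> (n <= t)%N /\ row t = n) ->
    (count A (iota 0 T) <= N n)%N ->
    \sum_(n <= t < T) (if A t then 2^-1 * `|a t| else - (d t * `|a t|)) <=
      `|\sum_(n <= t < T) a t *: w (row t) (l t)|.
Proof.
have [U [UU Uoo]] := @ultraFilterLemma nat \oo _.
have [|||l lP] := @dependent_selection (extendable U).
- move=> T l l' ll' ext n p sg nT adm pN.
  rewrite -(@pattern_cone_ext n l p T l' p); first exact: ext.
  by move=> t /ll'.
- move=> n p sg; rewrite leqn0 => /eqP -> _; rewrite add0n => pN.
  exact: extendable_start.
- by move=> T l ext; exact: extendable_step.
exists l => n T A a adm cA.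
have [nT|Tn] := leqP n T; last by rewrite !big_geq ?normr0// ltnW.
pose p t := if A t then Some (a t < 0) else None.
have pE : picks p T = count A (iota 0 T).
  by apply: eq_count => t; rewrite /p; case: (A t).
have adm' t : (t < T)%N -> isSome (p t) -> (n <= t)%N /\ row t = n.
  by move=> tT; rewrite /p; case: ifP => // At _; exact: adm.
have := lP T n p (nseq (N n - picks p T) false) nT adm'.
rewrite size_nseq pE subnKC// => /(_ erefl) /(@select_consistent _ _ _ _ UU);
  apply.
elim: T nT {adm adm' cA pE} => [|T IH].
  by rewrite leqn0 => /eqP ->; rewrite !big_geq.
rewrite leq_eqVlt => /orP[/eqP <-|];
  first by rewrite !big_geq// pattern_cone_lt.
rewrite ltnS => nT; rewrite !big_nat_recr//= ltnNge nT /= /p.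
case: ifP => AT.
- exists (\sum_(n <= t < T) a t *: w (row t) (l t)),
    (\sum_(n <= t < T) (if A t then 2^-1 * `|a t| else - (d t * `|a t|))), (a T).
  split=> //=; first exact: IH.
  rewrite mul0r subr0 lerD2l /half_sign mulrAC mulrC.
  by rewrite [`|_|]normrEsign mulrC.
- exists (\sum_(n <= t < T) a t *: w (row t) (l t)),
    (\sum_(n <= t < T) (if A t then 2^-1 * `|a t| else - (d t * `|a t|))), (a T).
  split=> //=; first exact: IH.
  by rewrite mul0r addr0.
Qed.

End Selection.

(** * Spreading models and the Krivine set *)

Lemma lp_norm1 (R : realType) n (a : 'I_n -> R) :
  lp_norm 1%:E a = \sum_(i < n) `|a i|.
Proof.
rewrite /lp_norm invr1 powRr1; first by apply: eq_bigr => i _; rewrite powRr1.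
by apply: sumr_ge0 => i _; exact: powR_ge0.
Qed.

(** The error eps n of a spreading model is tied to the number n of terms. It
is made small for fixed n by padding the sum with zero coefficients on far-out
terms. *)
Lemma spreading_approx (R : realType) (X E : completeNormedModType R)
    (x : nat -> X) (xt : nat -> E) (n : nat) (h M : R) :
  spreading_model x xt -> 0 < h -> 0 < M ->
  exists K, forall (a : nat -> R) (k : nat -> nat),
    (forall i, (i < n)%N -> `|a i| <= M) ->
    (forall i, (i < n)%N -> (K <= k i)%N) ->
    (forall i j, (i < j < n)%N -> (k i < k j)%N) ->
    `| `|\sum_(i < n) a i *: x (k i)| - `|\sum_(i < n) a i *: xt i| | < h.
Proof.
move=> [_ _ [eps [_ eps0 sp]]] h0 M0.
have hM0 : 0 < h / M by rewrite divr_gt0.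
have /cvgrPdist_lt/(_ _ hM0)[m0 _ epsm] := eps0.
pose m := maxn m0 n.+1; exists m => a k aM kK kinc.
have nm : (n <= m)%N by rewrite leq_max leqnSn orbT.
have emlt : eps m < h / M.
  have := epsm m (leq_maxl _ _); rewrite sub0r normrN;
    exact/le_lt_trans/ler_norm.
pose a' i := if (i < n)%N then M^-1 * a i else 0.
(* The padding indices start beyond all the k i. *)
pose B := (\sum_(j < n) k j + m)%N.
pose k' i := if (i < n)%N then k i else (B + i)%N.
have kB i : (i < n)%N -> (k i <= B)%N.
  move=> lin; rewrite /B (bigD1 (Ordinal lin)) //= -addnA; exact: leq_addr.
have main (W : normedModType R) (e : nat -> W) : \sum_(i < m) a' i *: e i =
    M^-1 *: \sum_(i < n) a i *: e i.
  by rewrite scaler_sumr; under [RHS]eq_bigr do rewrite scalerA;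
    rewrite (sum_widen (fun i => M^-1 * a i) e nm).
have := sp m (fun i => a' i) (fun i => k' i).
rewrite (main X (fun i => x (k' i))) (main E xt).
rewrite !normrZ gtr0_norm ?invr_gt0// -mulrBr normrM gtr0_norm ?invr_gt0//.
under eq_bigr => i _ do rewrite /k' ltn_ord.
move=> H; have {}H hyp1 hyp2 hyp3 hyp4 := lt_trans (H hyp1 hyp2 hyp3 hyp4) emlt.
rewrite -(ltr_pM2l (eqbRL (invr_gt0 _) M0)) [ltRHS]mulrC; apply: H.
- by rewrite leq_max ltn0Sn orbT.
- move=> i; rewrite /a'; case: ifP => [lin|_]; last by rewrite normr0.
  by rewrite normrM gtr0_norm ?invr_gt0// ler_pdivrMl// mulr1 aM.
- move=> i; rewrite /k'; case: ifP => [lin|_]; first by rewrite leqW// kK.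
  by rewrite leqW// /B -addnA; apply: leq_trans (leq_addl _ _); exact: leq_addr.
- move=> i j ij; rewrite /k'; case: ifP => lin; case: ifP => ljn.
  + by apply: kinc; rewrite ij.
  + by rewrite -addn1 leq_add ?kB//; apply: leq_ltn_trans ij.
  + by move: lin; rewrite (ltn_trans ij ljn).
  + by rewrite ltn_add2l.
Qed.

Lemma weakly_null_comb (R : realType) (V : normedModType R) (z : nat -> V)
    m (lam : nat -> R) (k : nat -> nat -> nat) :
  weakly_null z -> (forall i j, (j <= k i j)%N) ->
  weakly_null (fun j => \sum_(i < m) lam i *: z (k i j)).
Proof.
move=> wz kj f fc; elim: m => [|m IH].
  under eq_fun do rewrite big_ord0 linear0.
  exact: cvg_cst.
under eq_fun do rewrite big_ord_recr /= linearD linearZ /=.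
rewrite -[0]addr0; apply: cvgD => //.
rewrite -[0](mulr0 (lam m)); apply: cvgMr.
apply: (@cvg_comp _ _ _ (k m) (fun n => f (z n)) \oo \oo) => //; last exact: wz.
move=> A [n _ nA]; exists n => // j /= nj; apply: nA => /=.
exact: leq_trans nj (kj _ _).
Qed.

(** The blocks of zt given by the Krivine set, with the distortion 1 + 1/2, are
copied on z. Each w j is such a copy, far out in z so that the norms of N.+1
copies differ from those of the blocks by a small fraction of the l_1 norm of
the coefficients. *)
Lemma krivine_row (R : realType) (X F : completeNormedModType R)
    (z : nat -> X) (zt : nat -> F) (N : nat) :
  weakly_null z -> spreading_model z zt -> krivine_set zt 1%:E ->
  exists w : nat -> X, [/\ weakly_null w, forall j, `|w j| <= 3 &
    forall (s : seq nat) (a : nat -> R), size s = N.+1 -> sorted ltn s ->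
      2^-1 * \sum_(i < N.+1) `|a i| <=
        `|\sum_(i < N.+1) a i *: w (nth 0%N s i)|].
Proof.
move=> wz sp [_ /(_ 2^-1 N.+1)];
  rewrite invr_gt0 ltr0n => /(_ isT)[m [lam0 kr]].
pose lam k := if insub k is Some i then lam0 i else 0.
pose y i := \sum_(k < m) lam k *: zt (i * m + k)%N.
have lamE (k : 'I_m) : lam0 k = lam k by rewrite /lam valK.
have c23 : (1 + 2^-1)^-1 = 2 / 3 :> R.
  by rewrite (_ : 1 + 2^-1 = 3 / 2) ?invf_div//; lra.
have {}kr (a : nat -> R) : 2 / 3 * \sum_(i < N.+1) `|a i| <=
    `|\sum_(i < N.+1) a i *: y i| <= (1 + 2^-1) * \sum_(i < N.+1) `|a i|.
  have yE : \sum_(i < N.+1) a i *: y i = \sum_(i < N.+1) a i *: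
      \sum_(k < m) lam0 k *: zt (i * m + k)%N.
    by apply: eq_bigr => i _; congr (_ *: _); apply: eq_bigr => k _;
      rewrite lamE.
  by rewrite yE -c23; have := kr (fun i => a i); rewrite lp_norm1.
have m_gt0 : (0 < m)%N.
  rewrite lt0n; apply/eqP => m0.
  have /andP[+ _] := kr (fun i => (i == 0%N)%:R).
  rewrite big_ord_recl eqxx normr1 big1 => [|i _]; last by rewrite normr0.
  rewrite big1 ?normr0; last first.
    by move=> i _; rewrite /y; clear -m0; subst m; rewrite big_ord0 scaler0.
  lra.
(* The spreading model is compared with z on coefficients a_i lam_k, which are
   bounded by L when the a_i are bounded by 1. *)
pose L := 1 + \sum_(k < m) `|lam k|.
have L1 : 1 <= L by rewrite lerDl sumr_ge0.
have lamL k : (k < m)%N -> `|lam k| <= L.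
  move=> km; rewrite /L (bigD1 (Ordinal km)) //= addrCA.
  by rewrite lerDl addr_ge0// sumr_ge0.
have L0 : 0 < L by lra.
have h0 : 0 < 6^-1 :> R by lra.
have [K KP] := spreading_approx (N.+1 * m) sp h0 L0.
pose w j := \sum_(k < m) lam k *: z ((j + K) * m + k)%N.
(* 6^-1 = 2/3 - 1/2 is what the lower estimate can lose. *)
have wP (k : nat -> nat) (a : nat -> R) :
    (forall i j, (i < j < N.+1)%N -> (k i < k j)%N) ->
    (forall i, (i < N.+1)%N -> `|a i| <= 1) ->
    `| `|\sum_(i < N.+1) a i *: w (k i)| - `|\sum_(i < N.+1) a i *: y i| | < 6^-1.
  move=> kinc a1.
  have fl (W : normedModType R) (e : nat -> W) :
      \sum_(h < N.+1 * m) (a (h %/ m)%N * lam (h %% m)%N) *: e h =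
      \sum_(i < N.+1) a i *: \sum_(j < m) lam j *: e (i * m + j)%N.
    rewrite (sum_flatten _ _ (fun h => (a (h %/ m)%N * lam (h %% m)%N) *: e h)).
    apply: eq_bigr => i _; rewrite scaler_sumr; apply: eq_bigr => j _.
    by rewrite divnMDl// divn_small// addn0 modnMDl modn_small// scalerA.
  pose kk h := ((k (h %/ m) + K) * m + h %% m)%N.
  have := KP (fun h => a (h %/ m)%N * lam (h %% m)%N) kk.
  rewrite (fl _ (fun h => z (kk h))) (fl _ zt).
  have -> : \sum_(i < N.+1) a i *: \sum_(j < m) lam j *: z (kk (i * m + j)%N) =
      \sum_(i < N.+1) a i *: w (k i).
    apply: eq_bigr => i _; congr (_ *: _); apply: eq_bigr => j _.
    by rewrite /kk divnMDl// divn_small// addn0 modnMDl modn_small.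
  apply.
  - move=> h hN; rewrite normrM -[L]mul1r ler_pM//.
      by apply: a1; rewrite ltn_divLR.
    by apply: lamL; rewrite ltn_mod.
  - move=> h _; rewrite /kk; apply: leq_trans (leq_addr _ _).
    by apply: leq_trans (leq_pmulr _ m_gt0); exact: leq_addl.
  - move=> h h' /andP[hh' h'N]; rewrite /kk.
    have hmod i : (i %% m < m)%N by rewrite ltn_mod.
    have := leq_div2r m (ltnW hh'); rewrite leq_eqVlt => /orP[/eqP dE|dlt].
      rewrite -dE ltn_add2l; move: hh'.
      by rewrite {1}(divn_eq h m) {1}(divn_eq h' m) dE ltn_add2l.
    have kl : (k (h %/ m) < k (h' %/ m))%N by rewrite kinc// dlt ltn_divLR.
    apply: (@leq_trans ((k (h %/ m) + K).+1 * m)%N).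
      by rewrite mulSnr ltn_add2l.
    by apply: leq_trans (leq_addr _ _); rewrite leq_mul2r ltn_add2r kl orbT.
exists w; split.
- apply: (@weakly_null_comb _ _ z m lam (fun i j => ((j + K) * m + i)%N) wz) => i j.
  apply: leq_trans (leq_addr _ _).
  by apply: leq_trans (leq_pmulr _ m_gt0); exact: leq_addr.
- move=> j.
  have := wP (fun i => j + i)%N (fun i => (i == 0%N)%:R).
  have /andP[_ +] := kr (fun i => (i == 0%N)%:R).
  rewrite !big_ord_recl /= !big1 ?addr0 ?scale1r ?normr1; first last.
  + by move=> i _; rewrite /= ?scale0r ?normr0.
  + by move=> i _; rewrite /= ?scale0r ?normr0.
  + by move=> i _; rewrite /= ?scale0r ?normr0.
  rewrite addn0 => yle H.
  have : `| `|w j| - `|y 0%N| | < 6^-1.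
    apply: H => [i i' /andP[ii' _]|i _]; first by rewrite ltn_add2l.
    by case: (i == 0%N); rewrite ?normr1 ?normr0.
  by rewrite ltr_norml => /andP[_]; lra.
- move=> s a ss so.
  set M := \sum_(i < N.+1) `|a i|.
  have M0 : 0 <= M by apply: sumr_ge0.
  have [->|Mn0] := eqVneq M 0; first by rewrite mulr0.
  have Mp : 0 < M by rewrite lt_neqAle eq_sym Mn0.
  have aM i : (i < N.+1)%N -> `|a i| <= M.
    move=> iN; rewrite /M (bigD1 (Ordinal iN)) //= lerDl; exact: sumr_ge0.
  have := wP (nth 0%N s) (fun i => M^-1 * a i).
  have sc (W : normedModType R) (e : nat -> W) :
      `|\sum_(i < N.+1) (M^-1 * a i) *: e i| = M^-1 * `|\sum_(i < N.+1) a i *: e i|.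
    under eq_bigr do rewrite -scalerA.
    by rewrite -scaler_sumr normrZ gtr0_norm// invr_gt0.
  rewrite (sc _ (fun i => w (nth 0%N s i))) sc -mulrBr normrM gtr0_norm ?invr_gt0//.
  move=> H.
  have : M^-1 * `| `|\sum_(i < N.+1) a i *: w (nth 0%N s i)| -
                   `|\sum_(i < N.+1) a i *: y i| | < 6^-1.
    apply: H => [i j /andP[ij jN]|i iN]; last first.
      rewrite normrM gtr0_norm ?invr_gt0// ler_pdivrMl// mulr1; exact: aM.
    apply: (sorted_ltn_nth ltn_trans) => //; rewrite inE ss//.
    exact: ltn_trans jN.
  rewrite ltr_pdivrMl// ltr_norml => /andP[+ _].
  by have /andP[+ _] := kr a; rewrite -/M; lra.
Qed.

(** * Spreading models not equivalent to the basis of l_1 *)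

(** Far out in x, the j-th term may be replaced by any of a long run of terms
lying between its neighbours. Some convex combination of that run has small
norm, and averaging the sums accordingly erases the j-th term. *)
Lemma spreading_suppress (R : realType) (X E : completeNormedModType R)
    (x : nat -> X) (xt : nat -> E) (n j : nat) (b : nat -> R) :
  weakly_null x -> spreading_model x xt -> (j < n)%N ->
  `|\sum_(i < n) (if i == j :> nat then 0 else b i) *: xt i| <=
    `|\sum_(i < n) b i *: xt i|.
Proof.
move=> wx sp jn; apply/ler_addgt0Pr => h h0.
pose b0 i := if i == j then 0 else b i.
pose M := 1 + \sum_(i < n) `|b i|.
have M1 : 1 <= M by rewrite lerDl sumr_ge0.
have M0 : 0 < M by lra.
have bM i : (i < n)%N -> `|b i| <= M.
  by move=> lin;
    rewrite /M (bigD1 (Ordinal lin)) //= addrCA lerDl addr_ge0// sumr_ge0.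
have h3 : 0 < h / 3 by lra.
have [K KP] := spreading_approx n sp h3 M0.
have [||N [t [t0 tP t1 tN]]] := @mazur _ _ x [set i | (K + j <= i)%N] (h / 3 / M) wx.
- by move=> i; exists (i + (K + j))%N; rewrite /= ?leq_addr ?leq_addl.
- by rewrite divr_gt0.
pose k (l i : nat) := if (i < j)%N then (K + i)%N else
  if i == j then l else (K + j + N + i)%N.
have kinc l : (K + j <= l)%N -> (l < N)%N -> forall i i', (i < i' < n)%N ->
    (k l i < k l i')%N.
  by move=> lK lN i i' /andP[ii' _]; rewrite /k; case: (ltngtP i j) => ?;
    case: (ltngtP i' j) => ?; lia.
have kK l : (K + j <= l)%N -> forall i, (i < n)%N -> (K <= k l i)%N.
  by move=> lK i _; rewrite /k; case: (ltngtP i j) => ?; lia.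
pose A := \sum_(i < n) b0 i *: x (k (K + j)%N i).
have AE l : \sum_(i < n) b i *: x (k l i) = A + b j *: x l.
  rewrite /A (bigD1 (Ordinal jn)) //= [in RHS](bigD1 (Ordinal jn)) //=.
  rewrite /b0 eqxx scale0r add0r addrC /k ltnn eqxx; congr (_ + _).
  by apply: eq_bigr => i; rewrite -val_eqE /= => /negbTE ->.
have A_le : `|\sum_(i < n) b0 i *: xt i| <= `|A| + h / 3.
  have N0 : (K + j <= K + j)%N by [].
  have := KP b0 (fun i => k (K + j)%N i).
  have b0M i : (i < n)%N -> `|b0 i| <= M.
    by move=> /bM; rewrite /b0; case: ifP => // _ _; rewrite normr0 ltW.
  move=> /(_ b0M (kK _ N0)) H.
  have /H : forall i i', (i < i' < n)%N -> (k (K + j) i < k (K + j) i')%N.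
    by move=> i i' /andP[ii' _]; rewrite /k; case: (ltngtP i j) => ?;
      case: (ltngtP i' j) => ?; lia.
  by rewrite -/A ltr_norml; lra.
have Al_le l : (l < N)%N -> t l * `|A + b j *: x l| <=
    t l * (`|\sum_(i < n) b i *: xt i| + h / 3).
  move=> lN; have [->|/tP lK] := eqVneq (t l) 0; first by rewrite !mul0r.
  rewrite ler_wpM2l// -AE.
  by have := KP b (k l) bM (kK l lK) (kinc l lK lN); rewrite ltr_norml; lra.
apply: (le_trans A_le).
have -> : A = \sum_(l < N) t l *: (A + b j *: x l) - b j *: \sum_(l < N) t l *: x l.
  rewrite scaler_sumr -sumrB -[LHS]scale1r -t1 scaler_suml.
  by apply: eq_bigr => l _; rewrite scalerDr !scalerA [b j * _]mulrC addrK.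
have B1 : `|b j *: \sum_(l < N) t l *: x l| <= h / 3.
  rewrite normrZ; apply: (@le_trans _ _ (M * (h / 3 / M))).
    by apply: ler_pM => //; [exact: bM|exact: ltW].
  by rewrite mulrC divfK// lt0r_neq0.
have B2 : `|\sum_(l < N) t l *: (A + b j *: x l)| <=
    `|\sum_(i < n) b i *: xt i| + h / 3.
  rewrite -[leRHS]mul1r -[X in X * _]t1 mulr_suml.
  apply: (le_trans (ler_norm_sum _ _ _)).
  by apply: ler_sum => l _; rewrite normrZ ger0_norm// Al_le.
have := ler_normB (\sum_(l < N) t l *: (A + b j *: x l)) (b j *: \sum_(l < N) t l *: x l).
lra.
Qed.

(** Multiplying one coefficient by a number of [0, 1] is a convex combination
of keeping and of erasing that coefficient. *)
Lemma spreading_contract (R : realType) (X E : completeNormedModType R)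
    (x : nat -> X) (xt : nat -> E) (n : nat) (b c : nat -> R) :
  weakly_null x -> spreading_model x xt -> (forall i, 0 <= c i <= 1) ->
  `|\sum_(i < n) (c i * b i) *: xt i| <= `|\sum_(i < n) b i *: xt i|.
Proof.
move=> wx sp c01.
suff H m : (m <= n)%N ->
    `|\sum_(i < n) (if (i < m)%N then c i * b i else b i) *: xt i| <=
    `|\sum_(i < n) b i *: xt i|.
  by have := H n (leqnn n); under eq_bigr do rewrite ltn_ord.
elim: m => [|m IH] mn; first by under eq_bigr do rewrite ltn0.
apply: le_trans (IH (ltnW mn)).
pose g i := if (i < m)%N then c i * b i else b i.
have -> : \sum_(i < n) (if (i < m.+1)%N then c i * b i else b i) *: xt i =
    c m *: (\sum_(i < n) g i *: xt i) +
    (1 - c m) *: (\sum_(i < n) (if i == m :> nat then 0 else g i) *: xt i).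
  rewrite !scaler_sumr -big_split; apply: eq_bigr => i _ /=.
  rewrite !scalerA -scalerDl; congr (_ *: _); rewrite /g ltnS leq_eqVlt.
  have [->|im] := eqVneq (i : nat) m; first by rewrite ltnn mulr0 addr0.
  by rewrite -mulrDl addrC subrK mul1r.
have := c01 m => /andP[c0 c1].
have := spreading_suppress g wx sp mn.
rewrite -[leRHS]/(`|\sum_(i < n) g i *: xt i|).
set u := \sum_(i < n) _ *: xt i; set v := \sum_(i < n) g i *: xt i => uv.
apply: (le_trans (ler_normD _ _)).
rewrite !normrZ (ger0_norm c0) ger0_norm ?subr_ge0//.
have : (1 - c m) * `|u| <= (1 - c m) * `|v| by rewrite ler_wpM2l// subr_ge0.
lra.
Qed.

Lemma spreading_unconditional (R : realType) (X E : completeNormedModType R)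
    (x : nat -> X) (xt : nat -> E) (n : nat) (b c : nat -> R) :
  weakly_null x -> spreading_model x xt -> (forall i, `|c i| <= 1) ->
  `|\sum_(i < n) (c i * b i) *: xt i| <= 2 * `|\sum_(i < n) b i *: xt i|.
Proof.
move=> wx sp c1.
have -> : \sum_(i < n) (c i * b i) *: xt i =
    \sum_(i < n) (Num.max (c i) 0 * b i) *: xt i -
    \sum_(i < n) (Num.max (- c i) 0 * b i) *: xt i.
  rewrite -sumrB; apply: eq_bigr => i _; rewrite -scalerBl -mulrBl.
  congr ((_ * _) *: _); case: (lerP (c i) 0) => ci; case: lerP => ci'; lra.
apply: (le_trans (ler_normB _ _)); rewrite mulr2n mulrDl mul1r.
apply: lerD.
  apply: (@spreading_contract _ _ _ _ _ n b (fun i => Num.max (c i) 0) wx sp) => i.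
  have := c1 i; rewrite ler_norml le_max lexx orbT ge_max ler01 andbT.
  by move=> /andP[_ ->].
apply: (@spreading_contract _ _ _ _ _ n b (fun i => Num.max (- c i) 0) wx sp) => i.
have := c1 i; rewrite ler_norml le_max lexx orbT ge_max ler01 andbT.
by move=> /andP[+ _]; rewrite lerNl.
Qed.

(** Only the first i and the last n - i indices are missed by the window. *)
Lemma shift_sum_close (R : realType) (V : normedModType R) (F : nat -> V)
    (i n S : nat) :
  (i <= n)%N -> (forall h, (h < S + n)%N -> `|F h| <= 1) ->
  `|\sum_(h < S + n) F h - \sum_(s < S) F (s + i)%N| <= n%:R.
Proof.
move=> lin F1.
have -> : \sum_(s < S) F (s + i)%N = \sum_(i <= h < S + i) F h.
  by rewrite -{2}[i]add0n big_addn addnK big_mkord.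
rewrite -(big_mkord xpredT F) (@big_cat_nat _ _ _ i)//=; last first.
  exact: (leq_trans lin (leq_addl _ _)).
rewrite (@big_cat_nat _ _ _ (S + i) i)/=; last 2 first.
- exact: leq_addl.
- by rewrite leq_add2l.
rewrite addrA addrAC addrK; apply: (le_trans (ler_normD _ _)).
have bnd u v : (v <= S + n)%N -> `|\sum_(u <= h < v) F h| <= (v - u)%:R.
  move=> vS; apply: (le_trans (ler_norm_sum _ _ _)).
  rewrite -[leRHS]mulr1 -mulr_natl -[leRHS]mulr1 -sumr_const_nat.
  by rewrite !big_nat ?mulr1; apply: ler_sum => h /andP[_ hv];
    apply/F1/(leq_trans hv).
apply: (le_trans (lerD (bnd 0%N i _) (bnd (S + i)%N (S + n)%N (leqnn _)))).
  exact: (leq_trans lin (leq_addl _ _)).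
by rewrite -natrD ler_nat; lia.
Qed.

(** Let b be a combination whose norm is small compared with its l_1 norm. By
unconditionality, so is the norm of the combination with coefficients |b_i|
a_(s+i), for each shift s. Summing over s gives back (sum_i |b_i|) (sum_h a_h
x_h), up to the boundary terms. *)
Lemma not_l1_small_blocks (R : realType) (X E : completeNormedModType R)
    (x : nat -> X) (xt : nat -> E) (eta : R) :
  normalized x -> weakly_null x -> spreading_model x xt ->
  ~ equivalent_lp_basis 1%:E xt -> 0 < eta ->
  exists q K, (0 < q)%N /\ forall (a : nat -> R) (k : nat -> nat),
    (forall i, (i < q)%N -> `|a i| <= 1) ->
    (forall i, (i < q)%N -> (K <= k i)%N) ->
    (forall i j, (i < j < q)%N -> (k i < k j)%N) ->
    `|\sum_(i < q) a i *: x (k i)| <= eta * q%:R.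
Proof.
move=> nx wx sp nl1 eta0.
have xt2 i : `|xt i| <= 2.
  have [K KP] := spreading_approx i.+1 sp ltr01 (@ltr01 R).
  have := KP (fun j => (j == i)%:R) (fun j => K + j)%N.
  rewrite !big_ord_recr /= eqxx !scale1r !big1; first last.
  - by move=> j _; rewrite (ltn_eqF (ltn_ord j)) scale0r.
  - by move=> j _; rewrite (ltn_eqF (ltn_ord j)) scale0r.
  rewrite !add0r nx => H; have : `|1 - `|xt i| | < 1.
    apply: H => j; first by case: (j == i); rewrite ?normr1 ?normr0.
    - by rewrite leq_addr.
    - by move=> j' /andP[jj' _]; rewrite ltn_add2l.
  by rewrite ltr_norml; lra.
(* For each of the q terms, the translates cost 3 c and the boundary at most
   eta / 2. *)
pose c := eta / 8; have c0 : 0 < c by rewrite /c; lra.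
have [n [b bn]] : exists n (b : nat -> R),
    `|\sum_(i < n) b i *: xt i| < c * \sum_(i < n) `|b i|.
  apply: contrapT => nex; apply: nl1; exists c, 2; split=> // n a.
  rewrite lp_norm1; pose a' i := if insub i is Some j then a j else 0.
  have aE (i : 'I_n) : a i = a' i by rewrite /a' valK.
  have sE : \sum_(i < n) a i *: xt i = \sum_(i < n) a' i *: xt i.
    by apply: eq_bigr => i _; rewrite aE.
  have sE' : \sum_(i < n) `|a i| = \sum_(i < n) `|a' i|.
    by apply: eq_bigr => i _; rewrite aE.
  rewrite sE sE'; apply/andP; split.
    by rewrite leNgt; apply/negP => h; apply: nex; exists n, a'.
  apply: (le_trans (ler_norm_sum _ _ _)); rewrite mulr_sumr.
  by apply: ler_sum => i _; rewrite normrZ mulrC ler_wpM2r.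
pose B := \sum_(i < n) `|b i|.
have B0 : 0 < B by rewrite -(pmulr_rgt0 _ c0); apply: le_lt_trans bn.
have bB i : (i < n)%N -> `|b i| <= B.
  by move=> lin; rewrite /B (bigD1 (Ordinal lin)) //= lerDl sumr_ge0.
have [K KP] := spreading_approx n sp (mulr_gt0 c0 B0) B0.
pose S := (Num.truncn (2 * n%:R / eta)).+1.
have SP : 2 * n%:R <= eta * S%:R.
  by rewrite [leRHS]mulrC -ler_pdivrMr//; exact: ltW (truncnS_gt _).
exists (S + n)%N, K; split; first by rewrite addSn.
move=> a k a1 kK kinc.
pose F h := a h *: x (k h).
have F1 h : (h < S + n)%N -> `|F h| <= 1.
  by move=> hS; rewrite normrZ nx mulr1 a1.
pose V s := \sum_(i < n) (Num.sg (b i) * a (s + i)%N * b i) *: x (k (s + i)%N).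
have Vle s : (s < S)%N -> `|V s| <= 3 * c * B.
  move=> sS.
  pose th i := if (i < n)%N then Num.sg (b i) * a (s + i)%N else 0.
  have th1 i : `|th i| <= 1.
    rewrite /th; case: ifP => lin; last by rewrite normr0.
    rewrite normrM normr_sg -[leRHS]mulr1 ler_pM//; first by case: (b i != 0).
    by apply: a1; rewrite -addnS leq_add// ltnW.
  have := KP (fun i => th i * b i) (fun i => k (s + i)%N).
  have -> : \sum_(i < n) (th i * b i) *: x (k (s + i)%N) = V s.
    by apply: eq_bigr => i _; rewrite /th ltn_ord.
  move=> H.
  have : `| `|V s| - `|\sum_(i < n) (th i * b i) *: xt i| | < c * B.
    apply: H => [i lin|i lin|i j /andP[ij jn]].
    - by rewrite normrM -[leRHS]mul1r ler_pM// bB.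
    - by apply: kK; rewrite -addnS leq_add// ltnW.
    - by apply: kinc; rewrite ltn_add2l ij /= -addnS leq_add// ltnW.
  have := spreading_unconditional n b wx sp th1.
  by move: bn; rewrite -/B ltr_norml; lra.
have VE : \sum_(s < S) V s = \sum_(i < n) `|b i| *: \sum_(s < S) F (s + i)%N.
  rewrite exchange_big /=; apply: eq_bigr => i _.
  rewrite scaler_sumr; apply: eq_bigr => s _; rewrite /F scalerA.
  by congr (_ *: _); rewrite mulrAC -normrEsg.
have close : `|B *: \sum_(h < S + n) F h - \sum_(s < S) V s| <= B * n%:R.
  rewrite VE scaler_suml -sumrB mulr_suml;
    apply: (le_trans (ler_norm_sum _ _ _)).
  apply: ler_sum => i _; rewrite -scalerBr normrZ normr_id.
  apply: ler_wpM2l => //; apply: shift_sum_close => //; exact: ltnW.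
have VS : `|\sum_(s < S) V s| <= S%:R * (3 * c * B).
  apply: (le_trans (ler_norm_sum _ _ _)).
  rewrite -[S in S%:R]card_ord mulr_natl -sumr_const.
  by apply: ler_sum => s _; exact: Vle.
have : `|B *: \sum_(h < S + n) F h| <= B * (n%:R + S%:R * (3 * c)).
  rewrite -[_ *: _](subrK (\sum_(s < S) V s)).
  apply: (le_trans (ler_normD _ _)); lra.
rewrite normrZ gtr0_norm// ler_pM2l// => /le_trans; apply.
rewrite natrD mulrDr /c; have : 0 <= eta * n%:R by rewrite mulr_ge0// ltW.
have : 0 <= eta * S%:R by rewrite mulr_ge0// ltW.
by move: SP; lra.
Qed.

(** * Sequences with l_1-like coordinates *)

(** The bijection between pairs and natural numbers given by the 2-adic
valuation of the successor; the number of the row bounds the code from below.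
*)
Definition pair_code (m i : nat) := (2 ^ m * i.*2.+1).-1.
Definition code_row (t : nat) := logn 2 t.+1.
Definition code_col (t : nat) := (t.+1 %/ 2 ^ logn 2 t.+1)./2.

Lemma pair_codeS m i : (pair_code m i).+1 = (2 ^ m * i.*2.+1)%N.
Proof. by rewrite /pair_code prednK// muln_gt0 expn_gt0. Qed.

Lemma code_row_pair m i : code_row (pair_code m i) = m.
Proof.
rewrite /code_row pair_codeS lognM ?expn_gt0// pfactorK// logn_coprime ?addn0//.
by rewrite coprime2n /= odd_double.
Qed.

Lemma code_col_pair m i : code_col (pair_code m i) = i.
Proof.
have := code_row_pair m i; rewrite /code_row /code_col => ->.
by rewrite pair_codeS mulKn ?expn_gt0// /= uphalf_double.
Qed.

Lemma leq_pair_code m i : (m <= pair_code m i)%N.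
Proof.
rewrite -ltnS pair_codeS; apply: (@leq_trans (2 ^ m)); first exact: ltn_expl.
by rewrite leq_pmulr.
Qed.

(** The constant D_n of the lower estimate. It must not involve the sizes N_n,
as these are chosen depending on it. *)
Definition l1_const {R : realType} (n : nat) : R := 2 ^+ n * (24 * n%:R + 4).

Lemma count_mem_uniq_leq (J r : seq nat) :
  uniq r -> (count (mem J) r <= size J)%N.
Proof.
move=> ur; rewrite -size_filter; apply: uniq_leq_size; first exact: filter_uniq.
by move=> t; rewrite mem_filter => /andP[].
Qed.

(** All terms v_t chosen from all rows are listed in one sequence, t being the
code of a row m and a position i, and u_i combines the entries i of the rows m
<= i. For the coefficients b_t of a combination y of u, [schreier_selection]
bounds the l_1 norm over I, read off in the row n, except that the entries t <
n are out of reach. There are n of them, with coefficients at most M = max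
|a_i|, and the row 0 shows that M <= 4 |y|. *)
Lemma l1_coordinates_sequence (R : realType) (X F : completeNormedModType R)
    (z : nat -> X) (zt : nat -> F) (N : nat -> nat) :
  weakly_null z -> spreading_model z zt -> krivine_set zt 1%:E ->
  exists u : nat -> X, (forall i, `|u i| <= 6) /\
    forall (s : nat) (a : nat -> R),
      (forall i, (i < s)%N -> `|a i| <= 4 * `|\sum_(i < s) a i *: u i|) /\
      (forall n (I : seq nat), uniq I -> {in I, forall i, (n <= i < s)%N} ->
        (size I <= N n)%N ->
        \sum_(i <- I) `|a i| <= l1_const n * `|\sum_(i < s) a i *: u i|).
Proof.
move=> wz sp kr.
have /choice [w wP] n := krivine_row (N n) wz sp kr.
(* The tolerances add up to at most 1/4. *)
pose d t : R := 2^-1 ^+ (t + 3).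
have d_gt0 t : 0 < d t by rewrite exprn_gt0// invr_gt0.
have w_null m : weakly_null (w m) by have [] := wP m.
have w3 m j : `|w m j| <= 3 by have [_ + _] := wP m; apply.
have wl1 m : forall (s : seq nat) (a : nat -> R), size s = (N m).+1 ->
    sorted ltn s -> 2^-1 * \sum_(i < (N m).+1) `|a i| <=
      `|\sum_(i < (N m).+1) a i *: w m (nth 0%N s i)| by have [_ _] := wP m.
have [l lP] := schreier_selection code_row w_null d_gt0 wl1.
pose v t := w (code_row t) (l t).
pose c m : R := 2^-1 ^+ m.
have c_ge0 m : 0 <= c m by rewrite exprn_ge0// invr_ge0.
pose u i := \sum_(m < i.+1) c m *: v (pair_code m i).
exists u; split=> [i|s a].
  apply: (le_trans (ler_norm_sum _ _ _)).
  apply: (@le_trans _ _ (\sum_(m < i.+1) c m * 3)).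
    by apply: ler_sum => m _; rewrite normrZ ger0_norm// ler_wpM2l// w3.
  by rewrite -mulr_suml; have := sum_half_pow R i.+1; rewrite -/c; lra.
set y := \sum_(i < s) a i *: u i.
pose b t := if (code_row t <= code_col t < s)%N
  then a (code_col t) * c (code_row t) else 0.
have b_code m i : (m <= i < s)%N -> b (pair_code m i) = a i * c m.
  by move=> h; rewrite /b code_row_pair code_col_pair h.
pose T0 := (\sum_(i < s) \sum_(m < i.+1) (pair_code m i).+1)%N.
have codeT m i : (m <= i < s)%N -> (pair_code m i < T0)%N.
  move=> /andP[mi si]; rewrite /T0 (bigD1 (Ordinal si)) //=.
  rewrite (bigD1 (Ordinal (mi : (m < i.+1)%N))) //= -!addnA; exact: leq_addr.
have yE T : (T0 <= T)%N -> y = \sum_(0 <= t < T) b t *: v t.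
  move=> TT.
  pose J := [seq pair_code m i | i <- iota 0 s, m <- iota 0 i.+1].
  have uJ : uniq J.
    apply: allpairs_uniq_dep; [exact: iota_uniq|by move=> i _; exact: iota_uniq|].
    move=> [i m] [i' m'] _ _ /= h.
    have mm' : m = m' by rewrite -(code_row_pair m i) h code_row_pair.
    have ii' : i = i' by rewrite -(code_col_pair m i) h code_col_pair.
    by rewrite mm' ii'.
  pose C t := (code_row t <= code_col t < s)%N.
  have codeK t : pair_code (code_row t) (code_col t) = t.
    apply: succn_inj; rewrite pair_codeS /code_row /code_col.
    set e := logn 2 t.+1; have de : (2 ^ e %| t.+1)%N by exact: pfactor_dvdnn.
    have od : odd (t.+1 %/ 2 ^ e).
      have : coprime 2 (t.+1 %/ 2 ^ e).
        rewrite prime_coprime//; apply/negP => d2.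
        have : (2 ^ e.+1 %| t.+1)%N.
          by rewrite expnSr -(divnK de) mulnC dvdn_pmul2r// expn_gt0.
        by rewrite pfactor_dvdn// ltnn.
      by rewrite coprime2n.
    have := odd_double_half (t.+1 %/ 2 ^ e); rewrite od add1n => ->.
    by rewrite mulnC divnK.
  have pJ : perm_eq J [seq t <- index_iota 0 T | C t].
    apply: uniq_perm => //; first by rewrite filter_uniq// iota_uniq.
    move=> t; rewrite mem_filter mem_index_iota /=.
    apply/allpairsPdep/andP => [[i [m [+ + ->]]]|[Ct tT]].
      rewrite !mem_iota !add0n /= => si mi.
      have h : (m <= i < s)%N by rewrite -ltnS mi.
      by rewrite /C code_row_pair code_col_pair h (leq_trans (codeT _ _ h)).
    have /andP[C1 C2] := Ct.
    exists (code_col t), (code_row t); split; last by rewrite codeK.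
      by rewrite mem_iota.
    by rewrite mem_iota /= add0n ltnS.
  have -> : \sum_(0 <= t < T) b t *: v t = \sum_(t <- J) b t *: v t.
    rewrite (perm_big _ pJ) /= big_filter [RHS]big_mkcond /=;
      apply: eq_bigr => t _.
    by rewrite /b -/(C t); case: ifP => // _; rewrite scale0r.
  rewrite big_allpairs_dep /= /y -(big_mkord xpredT (fun i => a i *: u i)).
  rewrite /index_iota subn0; apply: eq_big_seq => i;
    rewrite mem_iota add0n /= => si.
  rewrite /u -(big_mkord xpredT (fun m => c m *: v (pair_code m i))).
  rewrite scaler_sumr /index_iota subn0; apply: eq_big_seq => m.
  rewrite mem_iota add0n /= ltnS => mi.
  by rewrite b_code ?mi// scalerA.
pose M := \big[Num.max/0]_(i < s) `|a i|.
have M0 : 0 <= M by exact: bigmax_ge_id.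
have aM i : (i < s)%N -> `|a i| <= M.
  by move=> si; exact: (le_bigmax _ (fun i : 'I_s => `|a i|) (Ordinal si)).
have bM t : `|b t| <= M.
  rewrite /b; case: ifP => [/andP[_ ts]|_]; last by rewrite normr0.
  rewrite normrM -[leRHS]mulr1 ler_pM ?aM// ger0_norm// exprn_ile1 ?invr_ge0//.
  by rewrite invf_le1// ler1n.
have sumd T : \sum_(t < T) d t <= 4^-1.
  have -> : \sum_(t < T) d t = 8^-1 * \sum_(t < T) 2^-1 ^+ t.
    rewrite mulr_sumr; apply: eq_bigr => t _; rewrite /d exprD mulrC;
      congr (_ * _).
    by rewrite exprVn -natrX.
  by have := sum_half_pow R T; lra.
have key n (I : seq nat) : uniq I -> {in I, forall i, (n <= i < s)%N} ->
    (size I <= (N n).+1)%N ->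
    2^-1 * (c n * \sum_(i <- I) `|a i|) <= `|y| + 3 * n%:R * M + 4^-1 * M.
  move=> uI In sI.
  pose T := (T0 + n)%N.
  pose J := map (pair_code n) I.
  have uJ : uniq J.
    rewrite map_inj_uniq// => i i' h.
    by rewrite -(code_col_pair n i) h code_col_pair.
  have JP t : t \in J -> [/\ (n <= t)%N, (t < T0)%N & code_row t = n].
    move=> /mapP[i iI ->]; split; [exact: leq_pair_code| |exact: code_row_pair].
    exact/codeT/In.
  have adm t : (t < T)%N -> mem J t -> (n <= t)%N /\ code_row t = n.
    by move=> _ /JP[].
  have cJ : (count (mem J) (iota 0 T) <= (N n).+1)%N.
    by apply: leq_trans (count_mem_uniq_leq J (iota_uniq 0 T)) _;
      rewrite size_map.
  have {adm cJ} := lP n T (mem J) b adm cJ.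
  have nT : (n <= T)%N by exact: leq_addl.
  have ytail : \sum_(n <= t < T) b t *: v t = y - \sum_(0 <= t < n) b t *: v t.
    by rewrite (yE T (leq_addr _ _)) (big_cat_nat (leq0n n) nT) /= [RHS]addrAC subrr add0r.
  rewrite -/v ytail.
  have headle : `|\sum_(0 <= t < n) b t *: v t| <= 3 * n%:R * M.
    rewrite big_mkord; apply: (le_trans (ler_norm_sum _ _ _)).
    apply: (@le_trans _ _ (\sum_(t < n) (3 * M))).
      by apply: ler_sum => t _; rewrite normrZ mulrC ler_pM// w3.
    by rewrite sumr_const card_ord -[X in X <= _]mulr_natr mulrAC.
  have lower : 2^-1 * (c n * \sum_(i <- I) `|a i|) - 4^-1 * M <=
      \sum_(n <= t < T) (if mem J t then 2^-1 * `|b t| else - (d t * `|b t|)).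
    have -> : 2^-1 * (c n * \sum_(i <- I) `|a i|) =
        \sum_(n <= t < T) (if mem J t then 2^-1 * `|b t| else 0).
      rewrite -[RHS]big_mkcond /= -[RHS]big_filter.
      have pJ : perm_eq [seq t <- index_iota n T | mem J t] J.
        apply: uniq_perm => //; first by rewrite filter_uniq// iota_uniq.
        move=> t; rewrite mem_filter mem_index_iota -[mem J t]/(t \in J).
        have [/JP[nt tT _]|//] := boolP (t \in J).
        by rewrite nt (leq_trans tT)// leq_addr.
      rewrite (perm_big _ pJ) /= big_map !mulr_sumr; apply: eq_big_seq => i iI.
      by rewrite b_code ?In// normrM (ger0_norm (c_ge0 n)) [_ * c n]mulrC.
    have dM : \sum_(n <= t < T) d t * M <= 4^-1 * M.
      rewrite -mulr_suml ler_wpM2r//; apply: le_trans (sumd T).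
      rewrite -(big_mkord xpredT d) (big_cat_nat (leq0n n) nT) /= lerDr.
      by apply: sumr_ge0 => t _; exact: ltW.
    apply: (le_trans (lerB (lexx _) dM)); rewrite -sumrB; apply: ler_sum => t _.
    have := d_gt0 t => /ltW dt0; case: ifP => _; last first.
      by rewrite sub0r lerN2; exact: ler_wpM2l.
    by rewrite gerBl; exact: mulr_ge0.
  have := ler_normB y (\sum_(0 <= t < n) b t *: v t).
  by move: lower headle; lra.
have M4 : M <= 4 * `|y|.
  suff : M <= 2 * `|y| + 2^-1 * M by lra.
  apply/bigmax_leP; split=> [|i _];
    first by rewrite addr_ge0// mulr_ge0// invr_ge0.
  have := key 0%N [:: i : nat] isT; rewrite big_seq1 /c expr0.
  have H : {in [:: i : nat], forall j, (0 <= j < s)%N}.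
    by move=> j; rewrite inE => /eqP ->; exact: ltn_ord.
  move=> /(_ H isT); rewrite mulr0n mulr0 mul0r addr0 mul1r.
  set A := `|_|; set Y := `|_|; lra.
split=> [i si|n I uI In sI]; first exact: le_trans (aM i si) M4.
have := key n I uI In (leqW sI).
have n0 : 0 <= n%:R :> R by exact: ler0n.
have : 3 * n%:R * M + 4^-1 * M <= (12 * n%:R + 1) * `|y|.
  have -> : (12 * n%:R + 1) * `|y| = 3 * n%:R * (4 * `|y|) + 4^-1 * (4 * `|y|).
    by lra.
  by apply: lerD; rewrite ler_wpM2l ?invr_ge0// mulr_ge0.
move=> h1 h2; rewrite /l1_const -mulrA -ler_pdivrMl ?exprn_gt0//.
by move: h1 h2; rewrite /c exprVn; lra.
Qed.

(** * Domination of a sparse subsequence *)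

(** Sort the indices by decreasing |a_i| and cut them into groups of q. The
norm of a group is at most eta q times its largest coefficient, which is at
most the mean of the |a_i| over the preceding group; the bounds add up to eta
sum |a_i|. The incomplete group is put first and bounded trivially. *)
Lemma small_sum (R : realType) (X : normedModType R) (x : nat -> X)
    (eta : R) (q K : nat) :
  normalized x -> 0 <= eta ->
  (forall (a : nat -> R) (k : nat -> nat),
    (forall i, (i < q)%N -> `|a i| <= 1) ->
    (forall i, (i < q)%N -> (K <= k i)%N) ->
    (forall i j, (i < j < q)%N -> (k i < k j)%N) ->
    `|\sum_(i < q) a i *: x (k i)| <= eta * q%:R) ->
  (0 < q)%N ->
  forall (p : nat -> nat) (s : seq nat) (a : nat -> R) (M : R),
    {homo p : i j / (i < j)%N} -> uniq s ->
    {in s, forall i, (K <= p i)%N} -> 0 <= M -> {in s, forall i, `|a i| <= M} ->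
    `|\sum_(i <- s) a i *: x (p i)| <=
      eta * (\sum_(i <- s) `|a i|) + (1 + eta) * q%:R * M.
Proof.
move=> nx eta0 small q0 p s a M pinc us sK M0 aM.
have block (t : seq nat) (B : R) : size t = q -> uniq t ->
    {in t, forall i, (K <= p i)%N} -> 0 <= B -> {in t, forall i, `|a i| <= B} ->
    `|\sum_(i <- t) a i *: x (p i)| <= eta * q%:R * B.
  move=> tq ut tK B0 tB.
  have [B_eq0|Bn0] := eqVneq B 0.
    by have := normalized_sum_le p nx (leqnn _) B0 tB; rewrite B_eq0 !mulr0.
  have Bp : 0 < B by rewrite lt_neqAle eq_sym Bn0.
  set t' := sort leq t.
  have pt : perm_eq t t' by rewrite perm_sym /t' perm_sort.
  have st' : size t' = q by rewrite /t' size_sort.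
  have so : sorted ltn t'.
    by rewrite ltn_sorted_uniq_leq -(perm_uniq pt) ut sort_sorted//;
      exact: leq_total.
  have t'mem i : (i < q)%N -> nth 0%N t' i \in t.
    by move=> iq; rewrite (perm_mem pt) mem_nth// st'.
  have := small (fun i => B^-1 * a (nth 0%N t' i)) (fun i => p (nth 0%N t' i)).
  rewrite (perm_big _ pt) /= (big_nth 0%N) big_mkord st' => H.
  rewrite -ler_pdivrMr// mulrC -[B^-1]gtr0_norm ?invr_gt0// -normrZ scaler_sumr.
  under eq_bigr do rewrite scalerA.
  apply: H => [i iq|i iq|i j /andP[ij jq]].
  - rewrite normrM gtr0_norm ?invr_gt0// ler_pdivrMl// mulr1.
    exact/tB/t'mem.
  - exact/tK/t'mem.
  - apply: pinc; apply: (sorted_ltn_nth ltn_trans) => //; rewrite inE st'//.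
    exact: ltn_trans jq.
pose r := [rel i j | `|a j| <= `|a i|].
have rtrans : transitive r by move=> j i k /= ij jk; exact: le_trans ij.
have peel g : forall (t : seq nat) (B : R), size t = (g * q)%N -> uniq t ->
    pairwise r t -> {in t, forall i, (K <= p i)%N} -> 0 <= B ->
    {in t, forall i, `|a i| <= B} ->
    `|\sum_(i <- t) a i *: x (p i)| <=
      eta * q%:R * B + eta * \sum_(i <- t) `|a i|.
  elim: g => [|g IH] t B tg ut rt tK B0 tB.
    have -> : t = [::] by apply: size0nil; rewrite tg.
    by rewrite !big_nil normr0 mulr0 addr0 !mulr_ge0// ler0n.
  rewrite mulSn in tg.
  have tq : size (take q t) = q by rewrite size_takel// tg leq_addr.
  have td : size (drop q t) = (g * q)%N by rewrite size_drop tg addKn.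
  move: ut rt; rewrite -{1 2}(cat_take_drop q t) cat_uniq pairwise_cat.
  move=> /and3P[u1 _ u2] /and3P[r12 r1 r2].
  have t1 i : i \in take q t -> i \in t by exact: mem_take.
  have t2 i : i \in drop q t -> i \in t by exact: mem_drop.
  (* The largest coefficient of the remaining groups. *)
  pose B' := if drop q t is h :: _ then `|a h| else 0.
  have B'0 : 0 <= B' by rewrite /B'; case: (drop q t).
  have B'd : {in drop q t, forall i, `|a i| <= B'}.
    rewrite /B'; case: (drop q t) r2 => [//|h t'] /= /andP[/allP rh _] i.
    by rewrite inE => /orP[/eqP -> //|/rh].
  have B't : {in take q t, forall i, B' <= `|a i|}.
    rewrite /B' => i it; case: (drop q t) r12 => [//|h t'].
    by move=> /allrelP/(_ i h it (mem_head _ _)).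
  have qB' : q%:R * B' <= \sum_(i <- take q t) `|a i|.
    rewrite -[in q%:R]tq; move: B't; elim: (take q t) => [|i t' IH'] ti.
      by rewrite big_nil mul0r.
    rewrite big_cons /= -natr1 mulrDl mul1r addrC lerD//.
      by apply: ti; rewrite mem_head.
    by apply: IH' => j jt; apply: ti; rewrite inE jt orbT.
  rewrite -(cat_take_drop q t) !big_cat /=.
  apply: (le_trans (ler_normD _ _)).
  have := block _ B tq u1 (sub_in1 t1 tK) B0 (sub_in1 t1 tB).
  have := IH _ B' td u2 r2 (sub_in1 t2 tK) B'0 B'd.
  have := ler_wpM2l eta0 qB'.
  by rewrite !mulrDr; lra.
set t := sort r s.
have pst : perm_eq s t by rewrite perm_sym /t perm_sort.
have ut : uniq t by rewrite -(perm_uniq pst).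
have rt : pairwise r t.
  by rewrite -sorted_pairwise// sort_sorted// => i j /=; exact: le_total.
have memt i : i \in t -> i \in s by rewrite (perm_mem pst).
rewrite !(perm_big _ pst) /=.
pose m := (size t %% q)%N.
have mt : (m <= size t)%N by exact: leq_mod.
have dt : size (drop m t) = (size t %/ q * q)%N.
  by rewrite size_drop {1}(divn_eq (size t) q) addnK.
have ud : uniq (drop m t) by exact: drop_uniq.
have rd : pairwise r (drop m t).
  by move: rt; rewrite -{1}(cat_take_drop m t) pairwise_cat => /and3P[].
have t1 i : i \in take m t -> i \in s by move=> /mem_take; exact: memt.
have t2 i : i \in drop m t -> i \in s by move=> /mem_drop; exact: memt.
have P1 := normalized_sum_le p nx (leqnn _) M0 (sub_in1 t1 aM).
have P2 := peel _ _ M dt ud rd (sub_in1 t2 sK) M0 (sub_in1 t2 aM).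
rewrite -[in leLHS](cat_take_drop m t) big_cat /=.
apply: (le_trans (ler_normD _ _)).
have P3 : (size (take m t))%:R * M <= q%:R * M.
  by rewrite ler_wpM2r// ler_nat size_takel// ltnW// ltn_mod.
have P4 : \sum_(i <- drop m t) `|a i| <= \sum_(i <- t) `|a i|.
  by rewrite -{2}(cat_take_drop m t) big_cat /= lerDr sumr_ge0.
have := ler_wpM2l eta0 P4.
by rewrite mulrDl mul1r mulrDl; lra.
Qed.

Lemma l1_const_gt0 (R : realType) n : 0 < l1_const n :> R.
Proof.
by rewrite mulr_gt0 ?exprn_gt0// ltr_wpDl// mulr_ge0.
Qed.

Section Levels.
Context (R : realType) (X : normedModType R) (x : nat -> X) (p : nat -> nat).
Context (K : nat -> nat) (Q D : nat -> R).
Hypothesis nx : normalized x.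
Hypothesis Kp : forall n i, (n <= i)%N -> (K n <= p i)%N.
Hypothesis Q_ge0 : forall n, 0 <= Q n.
Hypothesis D_gt0 : forall n, 0 < D n.
Hypothesis small : forall n (s : seq nat) (a : nat -> R) (M : R),
  uniq s -> {in s, forall i, (K n <= p i)%N} -> 0 <= M ->
  {in s, forall i, `|a i| <= M} ->
  `|\sum_(i <- s) a i *: x (p i)| <=
    2^-1 ^+ n / D n * (\sum_(i <- s) `|a i|) + Q n * M.

(** Thresholds for the coefficients. The denominator makes n terms below the
threshold, and the error Q n times the threshold, summable in n. *)
Definition level (n : nat) : R :=
  if n is 0 then 4 else 2^-1 ^+ n / (n%:R + 1 + Q n).

(** A number so large that this many coefficients above the threshold level
n.+1 have a sum greater than D n. *)
Definition level_card (n : nat) : nat := (Num.truncn (D n / level n.+1)).+1.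

Lemma level_gt0 n : 0 < level n.
Proof.
case: n => [|n] //=; rewrite divr_gt0 ?exprn_gt0 ?invr_gt0//.
by have := Q_ge0 n.+1; have : 0 <= n.+1%:R :> R by []; lra.
Qed.

Lemma level_le n : (0 < n)%N -> n%:R * level n + Q n * level n <= 2^-1 ^+ n.
Proof.
case: n => // n _; rewrite -mulrDl /level mulrA ler_pdivrMr; last first.
  by have := Q_ge0 n.+1; have : 0 <= n.+1%:R :> R by []; lra.
by rewrite mulrC ler_wpM2l ?exprn_ge0 ?invr_ge0//; lra.
Qed.

(** Pass from the coefficients below level n to those below level n.+1. The
ones in between are few beyond n: at most [level_card n], so that D n bounds
their sum and [small] applies. The ones before n are at most n in number. *)
Lemma level_sum_le (s : nat) (a : nat -> R) :
  (forall i, (i < s)%N -> `|a i| <= 4) ->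
  (forall n (I : seq nat), uniq I -> {in I, forall i, (n <= i < s)%N} ->
     (size I <= level_card n)%N -> \sum_(i <- I) `|a i| <= D n) ->
  `|\sum_(i < s) a i *: x (p i)| <= 4 * Q 0%N + 5.
Proof.
move=> a4 aD; have [->|s0] := posnP s.
  by rewrite big_ord0 normr0; have := Q_ge0 0%N; lra.
pose fix lev n := if n is n'.+1 then [seq i <- lev n' | `|a i| <= level n]
  else iota 0 s.
have lev_uniq n : uniq (lev n).
  by elim: n => [|n IH] /=; [exact: iota_uniq|exact: filter_uniq].
have lev_lt n i : i \in lev n -> (i < s)%N.
  elim: n => [|n IH] /=; first by rewrite mem_iota.
  by rewrite mem_filter => /andP[_ /IH].
have lev_le n i : i \in lev n -> `|a i| <= level n.
  case: n => [|n] /=; first by rewrite mem_iota => /a4.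
  by rewrite mem_filter => /andP[].
pose G n := `|\sum_(i <- lev n) a i *: x (p i)|.
have step n : G n <= G n.+1 + (n%:R * level n + 2^-1 ^+ n + Q n * level n).
  pose B := [seq i <- lev n | ~~ (`|a i| <= level n.+1)].
  pose H := [seq i <- B | (i < n)%N].
  pose I := [seq i <- B | ~~ (i < n)%N].
  have -> : G n = `|\sum_(i <- lev n.+1) a i *: x (p i) +
      (\sum_(i <- H) a i *: x (p i) + \sum_(i <- I) a i *: x (p i))|.
    rewrite /G (sum_filterC (fun i => `|a i| <= level n.+1) (lev n)) -/B.
    by rewrite (sum_filterC (fun i => i < n)%N B).
  have BL i : i \in B -> i \in lev n by rewrite mem_filter => /andP[].
  have uB : uniq B by exact: filter_uniq.
  have Hle : `|\sum_(i <- H) a i *: x (p i)| <= n%:R * level n.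
    apply: normalized_sum_le => //; [|exact/ltW/level_gt0|].
    - rewrite -[X in (_ <= X)%N](size_iota 0); apply: uniq_leq_size.
        exact: filter_uniq.
      by move=> i; rewrite mem_filter mem_iota => /andP[].
    - by move=> i; rewrite mem_filter => /andP[_ /BL /lev_le].
  have uI : uniq I by exact: filter_uniq.
  have IL i : i \in I -> i \in lev n by rewrite mem_filter => /andP[_ /BL].
  have In : {in I, forall i, (n <= i < s)%N}.
    move=> i iI; rewrite (lev_lt n)//; last exact: IL.
    by move: iI; rewrite mem_filter -leqNgt => /andP[->].
  have Ia : {in I, forall i, level n.+1 <= `|a i|}.
    by move=> i; rewrite 2!mem_filter -ltNge => /and3P[_ /ltW].
  have sI : (size I <= level_card n)%N.
    rewrite leqNgt; apply/negP => big.
    have st : size (take (level_card n) I) = level_card n by rewrite size_takel// ltnW.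
    have tI i : i \in take (level_card n) I -> i \in I by exact: mem_take.
    have := aD n (take (level_card n) I) (take_uniq _ uI) (sub_in1 tI In).
    rewrite st leqnn => /(_ isT); apply/negP; rewrite -ltNge.
    apply: (@lt_le_trans _ _ ((level_card n)%:R * level n.+1)).
      by rewrite -ltr_pdivrMr ?level_gt0// truncnS_gt.
    rewrite -[X in X%:R]st; move: (sub_in1 tI Ia).
    elim: (take _ I) => [|i t IH] ta; first by rewrite big_nil mul0r.
    rewrite big_cons /= -natr1 mulrDl mul1r addrC lerD//.
      by apply: ta; rewrite mem_head.
    by apply: IH => j jt; apply: ta; rewrite inE jt orbT.
  have ID := aD n I uI In sI.
  have IK : {in I, forall i, (K n <= p i)%N} by move=> i /In /andP[/Kp].
  have := small uI IK (ltW (level_gt0 n)) (fun i iI => lev_le n i (IL i iI)).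
  have : 2^-1 ^+ n / D n * (\sum_(i <- I) `|a i|) <= 2^-1 ^+ n.
    rewrite -[leRHS](divfK (lt0r_neq0 (D_gt0 n))) ler_wpM2l// divr_ge0 ?exprn_ge0 ?invr_ge0//.
    exact: ltW.
  have := ler_normD (\sum_(i <- lev n.+1) a i *: x (p i))
    (\sum_(i <- H) a i *: x (p i) + \sum_(i <- I) a i *: x (p i)).
  have := ler_normD (\sum_(i <- H) a i *: x (p i)) (\sum_(i <- I) a i *: x (p i)).
  by rewrite -/(G n.+1); lra.
have tot n : G 0%N <= G n.+1 + (2 * \sum_(m < n.+1) 2^-1 ^+ m + 4 * Q 0%N).
  elim: n => [|n IH].
    by rewrite big_ord_recr big_ord0 /= expr0; have := step 0%N;
      rewrite expr0 /=; lra.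
  apply: (le_trans IH); rewrite [in leRHS]big_ord_recr /= mulrDr.
  by have := step n.+1; have := @level_le n.+1 isT; lra.
have -> : `|\sum_(i < s) a i *: x (p i)| = G 0%N.
  by rewrite -(big_mkord xpredT (fun i => a i *: x (p i))) /index_iota subn0.
have Gs : G s <= 1.
  apply: (@le_trans _ _ (s%:R * level s)).
    apply: normalized_sum_le => //; [|exact/ltW/level_gt0|exact: lev_le].
    rewrite -[X in (_ <= X)%N](size_iota 0);
      apply: uniq_leq_size => // i /lev_lt.
    by rewrite mem_iota.
  have := level_le s0.
  have : (2^-1 : R) ^+ s <= 1 by rewrite exprn_ile1 ?invr_ge0// invf_le1// ler1n.
  by have := mulr_ge0 (Q_ge0 s) (ltW (level_gt0 s)); lra.
by have := tot s.-1; rewrite prednK//; have := sum_half_pow R s; lra.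
Qed.

End Levels.

(** Order of the choices: the constants D_n are universal; they determine the
ratios eta_n = 2^-n / D_n, hence the numbers q_n and K_n of
[not_l1_small_blocks], the thresholds, and finally the sizes N_n, for which u
is constructed. *)
Lemma sparse_subsequence_dominated (R : realType) (X E F : completeNormedModType R)
    (x z : nat -> X) (xt : nat -> E) (zt : nat -> F) :
  normalized x -> weakly_null x -> spreading_model x xt ->
  ~ equivalent_lp_basis 1%:E xt ->
  weakly_null z -> spreading_model z zt -> krivine_set zt 1%:E ->
  exists (u : nat -> X) (p : nat -> nat) (C : R),
    [/\ forall i, `|u i| <= 1, {homo p : i j / (i < j)%N} &
      forall r n (a : nat -> R),
        `|\sum_(i < n) a i *: x (p (i + r)%N)| <=
          C * `|\sum_(i < n) a i *: u i|].
Proof.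
move=> nx wx spx nl1 wz spz kr.
pose eta n : R := 2^-1 ^+ n / l1_const n.
have eta0 n : 0 < eta n.
  by rewrite divr_gt0 ?l1_const_gt0// exprn_gt0// invr_gt0.
have /choice [qK qKP] n : exists qK : nat * nat, (0 < qK.1)%N /\
    forall (a : nat -> R) (k : nat -> nat),
    (forall i, (i < qK.1)%N -> `|a i| <= 1) ->
    (forall i, (i < qK.1)%N -> (qK.2 <= k i)%N) ->
    (forall i j, (i < j < qK.1)%N -> (k i < k j)%N) ->
    `|\sum_(i < qK.1) a i *: x (k i)| <= eta n * qK.1%:R.
  have [q [K qKP]] := not_l1_small_blocks nx wx spx nl1 (eta0 n).
  by exists (q, K).
pose K n := (qK n).2; pose Q n := (1 + eta n) * (qK n).1%:R.
have Q0 n : 0 <= Q n by rewrite mulr_ge0// addr_ge0// ltW.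
pose p i := (\sum_(n < i.+1) (K n).+1)%N.
have pinc : {homo p : i j / (i < j)%N}.
  by apply: homo_ltn; [exact: ltn_trans|move=> i; rewrite /p [in ltnRHS]big_ord_recr /= -addSnnS leq_addr].
have Kp n i : (n <= i)%N -> (K n <= p i)%N.
  move=> ni; rewrite /p (bigD1 (Ordinal (ni : (n < i.+1)%N))) //=.
  by rewrite (leq_trans (leqnSn _))// leq_addr.
have [u [u6 uP]] := l1_coordinates_sequence (level_card Q l1_const) wz spz kr.
exists (fun i => 6^-1 *: u i), p, (6 * (4 * Q 0%N + 5)).
split=> // [i|r s a].
  by rewrite normrZ gtr0_norm ?invr_gt0// ler_pdivrMl// mulr1.
have -> : \sum_(i < s) a i *: (6^-1 *: u i) = 6^-1 *: \sum_(i < s) a i *: u i.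
  by rewrite scaler_sumr; apply: eq_bigr => i _; rewrite !scalerA mulrC.
rewrite normrZ gtr0_norm ?invr_gt0// mulrA [6 * _]mulrC mulfK//.
have [a4 aI] := uP s a.
set y := \sum_(i < s) a i *: u i in a4 aI *.
pose p' i := p (i + r)%N.
have p'inc : {homo p' : i j / (i < j)%N}.
  by move=> i j ij; apply: pinc; rewrite ltn_add2r.
have Kp' n i : (n <= i)%N -> (K n <= p' i)%N.
  by move=> ni; apply: Kp; exact: (leq_trans ni (leq_addr _ _)).
have small n (t : seq nat) (b : nat -> R) (M : R) := @small_sum _ _ x (eta n)
  _ _ nx (ltW (eta0 n)) (qKP n).2 (qKP n).1 p' t b M p'inc.
have [y0|yn0] := eqVneq `|y| 0.
  rewrite y0 mulr0 big1 ?normr0// => i _.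
  have := a4 i (ltn_ord i); rewrite y0 mulr0 normr_le0 => /eqP ->.
  by rewrite scale0r.
have yp : 0 < `|y| by rewrite lt_neqAle eq_sym yn0 normr_ge0.
have sc i : `| `|y|^-1 * a i| = `|y|^-1 * `|a i|.
  by rewrite normrM gtr0_norm// invr_gt0.
have := @level_sum_le _ _ x p' K Q l1_const nx Kp' Q0 (@l1_const_gt0 R) small s
  (fun i => `|y|^-1 * a i).
under eq_bigr do rewrite -scalerA.
rewrite -scaler_sumr normrZ gtr0_norm ?invr_gt0// ler_pdivrMl// mulrC.
apply=> [i si|n I uI In sI].
  by rewrite sc ler_pdivrMl// mulrC a4.
under eq_bigr do rewrite sc.
by rewrite -mulr_sumr ler_pdivrMl// mulrC aI.
Qed.

(** * Operators on closed spans *)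

Lemma basic_sequence_free (R : realType) (V : normedModType R) (x : nat -> V)
    (n : nat) (a : nat -> R) :
  basic_sequence x -> \sum_(i < n) a i *: x i = 0 ->
  forall i, (i < n)%N -> a i = 0.
Proof.
move=> bx a0 i lin.
have [|b [_ bu]] := bx 0.
  by apply: subset_closure; exists 0%N, a; rewrite big_ord0.
pose a' i := if (i < n)%N then a i else 0.
have ba' : b = a'.
  apply: bu; apply: cvg_near_cst; exists n => // m /= nm.
  by rewrite /series /= big_mkord -(sum_widen a x nm).
have b0 : b = fun=> 0.
  apply: bu; apply: cvg_near_cst; apply: nearW => m.
  by rewrite /series /= big1// => j _; rewrite scale0r.
by have := congr1 (fun g => g i) (etrans (esym ba') b0); rewrite /a' lin.
Qed.

Lemma closure_span_submod (R : realType) (V : normedModType R) (u : nat -> V) :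
  closed_subspace (closure (seq_span u)).
Proof.
split; first exact: closed_closure.
have spanD a y y' : seq_span u y -> seq_span u y' -> seq_span u (a *: y + y').
  move=> [n [c ->]] [n' [c' ->]].
  by have [b ->] := sum_lincomb a c c' n n'; exists (maxn n n'), b.
split; first by rewrite inE; apply: subset_closure; exists 0%N, (fun=> 0);
  rewrite big_ord0.
move=> a y y'; rewrite !inE => cy cy' B.
have : (fun p : V * V => a *: p.1 + p.2) @ (y, y') --> a *: y + y'.
  apply: cvgD; last exact: cvg_snd.
  by apply: cvgZr; exact: cvg_fst.
move=> /[apply] -[[B1 B2] /= [yB1 y'B2] BB].
have [w [sw Bw]] := cy _ yB1; have [w' [sw' Bw']] := cy' _ y'B2.
exists (a *: w + w'); split; first exact: spanD.
by apply: (BB (w, w')).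
Qed.

Lemma closure_span_mem (R : realType) (V : normedModType R) (u : nat -> V) i :
  closure (seq_span u) (u i).
Proof.
apply: subset_closure; exists i.+1, (fun j => (j == i)%:R).
by rewrite sum_delta.
Qed.

(** The graph of T is the closure of the pairs (sum a_i u_i, sum a_i v_i). *)
Lemma extend_operator (R : realType) (X : completeNormedModType R)
    (u v : nat -> X) (C : R) :
  (forall n (a : nat -> R),
    `|\sum_(i < n) a i *: v i| <= C * `|\sum_(i < n) a i *: u i|) ->
  exists T : X -> X, bounded_linear_on (closure (seq_span u)) T /\
    forall i, T (u i) = v i.
Proof.
move=> C0uv; pose D := `|C| + 1.
have D0 : 0 < D by rewrite /D ltr_wpDl.
have uv n (a : nat -> R) :
    `|\sum_(i < n) a i *: v i| <= D * `|\sum_(i < n) a i *: u i|.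
  apply: (le_trans (C0uv n a)); apply: ler_wpM2r => //.
  by rewrite /D (le_trans (ler_norm C))// lerDl.
pose approx y w := forall e : R, 0 < e -> exists n (a : nat -> R),
  `|y - \sum_(i < n) a i *: u i| < e /\ `|w - \sum_(i < n) a i *: v i| < e.
have approx_bound y w : approx y w -> `|w| <= D * `|y|.
  move=> yw; apply/ler_addgt0Pr => e e0.
  have e'0 : 0 < e / (D + 1) by rewrite divr_gt0// addr_gt0.
  have [n [a [ya wa]]] := yw _ e'0.
  have := uv n a; set U := \sum_(i < n) a i *: u i in ya *.
  set W := \sum_(i < n) a i *: v i in wa * => WU.
  have h1 : `|w| <= `|w - W| + `|W| by rewrite -{1}[w](subrK W) ler_normD.
  have h2 : `|U| <= `|y - U| + `|y|.
    by rewrite -[X in `|X| <= _](subrK y) distrC ler_normD.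
  have h3 : D * `|U| <= D * (e / (D + 1)) + D * `|y|.
    by rewrite -mulrDr ler_wpM2l ?(ltW D0)//; lra.
  have : D * (e / (D + 1)) + e / (D + 1) = e.
    by rewrite -[X in _ + X]mul1r -mulrDl mulrC divfK// lt0r_neq0// addr_gt0.
  lra.
have approx_lin t y w y' w' : approx y w -> approx y' w' ->
    approx (t *: y + y') (t *: w + w').
  move=> yw yw' e e0.
  have e'0 : 0 < e / (`|t| + 1) by rewrite divr_gt0// ltr_wpDl.
  have [n [a [ya wa]]] := yw _ (divr_gt0 e'0 (ltr0n R 2)).
  have [n' [a' [ya' wa']]] := yw' _ (divr_gt0 e'0 (ltr0n R 2)).
  have [b bE] := sum_lincomb t a a' n n'; exists (maxn n n'), b.
  have est (p q p' q' : X) : `|p - q| < e / (`|t| + 1) / 2 ->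
      `|p' - q'| < e / (`|t| + 1) / 2 -> `|t *: p + p' - (t *: q + q')| < e.
    move=> pq pq'; rewrite opprD addrACA -scalerBr.
    apply: (le_lt_trans (ler_normD _ _)); rewrite normrZ.
    have t1 : `|t| * `|p - q| <= `|t| * (e / (`|t| + 1) / 2).
      by rewrite ler_wpM2l// ltW.
    have : `|t| * (e / (`|t| + 1)) + e / (`|t| + 1) = e.
      by rewrite -[X in _ + X]mul1r -mulrDl mulrC divfK// lt0r_neq0// ltr_wpDl.
    by have := normr_ge0 t; lra.
  by rewrite -!bE; split; exact: est.
have approx_u i : approx (u i) (v i).
  move=> e e0; exists i.+1, (fun j => (j == i)%:R).
  by rewrite !sum_delta !subrr normr0.
have approx_ex y : closure (seq_span u) y -> exists w, approx y w.
  move=> cy.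
  have /choice [na naP] : forall k : nat, exists na : nat * (nat -> R),
      `|y - \sum_(i < na.1) na.2 i *: u i| < 2^-1 ^+ k.
    move=> k; have k0 : 0 < (2^-1 : R) ^+ k by rewrite exprn_gt0// invr_gt0.
    have [_ [[n [a ->]] h]] := cy _ (nbhsx_ballx y _ k0).
    by exists (n, a); move: h; rewrite -ball_normE.
  pose Uk k := \sum_(i < (na k).1) (na k).2 i *: u i.
  pose Wk k := \sum_(i < (na k).1) (na k).2 i *: v i.
  have Wdiff k l : `|Wk k - Wk l| <= D * `|Uk k - Uk l|.
    have [b bE] := sum_lincomb (-1) (na l).2 (na k).2 (na l).1 (na k).1.
    have sE (g : nat -> X) : \sum_(i < (na k).1) (na k).2 i *: g i -
        \sum_(i < (na l).1) (na l).2 i *: g i =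
        \sum_(i < maxn (na l).1 (na k).1) b i *: g i.
      by rewrite -bE scaleN1r addrC.
    by rewrite /Wk /Uk !sE; exact: uv.
  have small (e : R) : 0 < e -> exists k, forall l, (k <= l)%N -> 2^-1 ^+ l < e.
    move=> e0.
    have h : `|2^-1 : R| < 1 by rewrite gtr0_norm ?invr_gt0// invf_lt1// ltr1n.
    have /cvgrPdist_lt/(_ e e0)[k _ kP] := cvg_expr h.
    exists k => l kl; have := kP l kl; rewrite sub0r normrN.
    by rewrite ger0_norm// exprn_ge0// invr_ge0.
  have Wc : cvg (Wk @ \oo).
    apply/cauchy_cvgP/cauchyP => e e0.
    have e'0 : 0 < e / D / 2 by rewrite !divr_gt0.
    have [k kP] := small _ e'0.
    exists (Wk k), k => // l /= kl; rewrite -ball_normE /=.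
    apply: (le_lt_trans (Wdiff k l)); rewrite mulrC -ltr_pdivlMr//.
    have -> : Uk k - Uk l = (y - Uk l) - (y - Uk k).
      by rewrite opprB [RHS]addrC addrA subrK.
    apply: (le_lt_trans (ler_normB _ _)).
    have := naP k; have := naP l; rewrite -/(Uk k) -/(Uk l).
    by have := kP l kl; have := kP k (leqnn k); lra.
  exists (lim (Wk @ \oo)) => e e0.
  have /cvgrPdist_lt/(_ e e0)[k1 _ k1P] := Wc.
  have [k2 k2P] := small e e0.
  pose k := maxn k1 k2; exists (na k).1, (na k).2; split.
    by apply: (lt_trans (naP k)); apply: k2P; exact: leq_maxr.
  by apply: k1P => /=; exact: leq_maxl.
have /choice [T TP] : forall y, exists w, closure (seq_span u) y -> approx y w.
  move=> y; have [/approx_ex[w yw]|nc] := pselect (closure (seq_span u) y).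
    by exists w.
  by exists 0.
have T_eq y w : closure (seq_span u) y -> approx y w -> T y = w.
  move=> /TP yT yw.
  have := approx_bound _ _ (approx_lin (-1) _ _ _ _ yT yw).
  rewrite !scaleN1r [- y + y]addrC subrr normr0 mulr0 normr_le0.
  by rewrite addrC subr_eq0 => /eqP.
have [_ [_ Yl]] := closure_span_submod u.
exists T; split; first split.
- move=> a y y' cy cy'; apply: T_eq; last first.
    by apply: approx_lin; exact: TP.
  by have := Yl a y y'; rewrite !inE; apply.
- by exists D => y cy; apply: approx_bound; exact: TP.
- move=> i; apply: T_eq; last exact: approx_u.
  exact: closure_span_mem.
Qed.

(** Four terms of a spreading model are linearly independent, and the norms of
combinations of four far-out terms of x converge to those in the spreading
model. *)
Lemma spreading_separated (R : realType) (X E : completeNormedModType R)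
    (x : nat -> X) (xt : nat -> E) (p : nat -> nat) (mu mu' : R) :
  spreading_model x xt -> {homo p : i j / (i < j)%N} ->
  mu != 0 \/ mu' != 0 ->
  exists g : R, 0 < g /\ exists K, forall i j, (K <= i)%N -> (i.+1 < j)%N ->
    g <= `|mu *: (x (p i) - x (p j)) + mu' *: (x (p i.+1) - x (p j.+1))|.
Proof.
move=> sp pinc mu0.
pose a := nth 0 [:: mu; mu'; - mu; - mu'].
have [_ bxt _] := sp.
pose g := `|\sum_(t < 4) a t *: xt t|.
have g0 : 0 < g.
  rewrite normr_gt0; apply/eqP => h.
  have := basic_sequence_free bxt h; move=> az.
  by case: mu0 => /eqP; apply; [exact: (az 0%N)|exact: (az 1%N)].
pose M := `|mu| + `|mu'| + 1.
have M0 : 0 < M by rewrite ltr_wpDl// addr_ge0.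
have [K KP] := spreading_approx 4 sp (divr_gt0 g0 (ltr0n R 2)) M0.
have pi i : (i <= p i)%N.
  by elim: i => // i IH; apply: leq_ltn_trans IH _; exact: pinc.
exists (g / 2); split; first by rewrite divr_gt0.
exists K => i j Ki ij.
have := KP a (nth 0%N [:: p i; p i.+1; p j; p j.+1]).
rewrite -/g !big_ord_recr big_ord0 /= add0r => H.
have -> : mu *: (x (p i) - x (p j)) + mu' *: (x (p i.+1) - x (p j.+1)) =
    mu *: x (p i) + mu' *: x (p i.+1) + - mu *: x (p j) + - mu' *: x (p j.+1).
  by rewrite !scalerBr !scaleNr addrACA addrA.
have : `| `|mu *: x (p i) + mu' *: x (p i.+1) + - mu *: x (p j) +
    - mu' *: x (p j.+1)| - g| < g / 2.
  apply: H.
  - have m0 := normr_ge0 mu; have m0' := normr_ge0 mu'.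
    by move=> [|[|[|[|t]]]]// _; rewrite /a /= ?normrN /M; lra.
  - have Kj : (K <= j)%N by rewrite (leq_trans Ki)// ltnW// ltnW.
    move=> [|[|[|[|t]]]]// _; apply: leq_trans (pi _) => //; exact: leqW.
  - have p1 : (p i < p i.+1)%N by exact: pinc.
    have p2 : (p i.+1 < p j)%N by exact: pinc.
    have p3 : (p j < p j.+1)%N by exact: pinc.
    by move=> [|[|[|[|s]]]] [|[|[|[|t]]]]//=; rewrite ?andbF// => _; lia.
by rewrite ltr_norml; lra.
Qed.

(** The pairs (T u_i - l u_i, T' u_i - l' u_i) lie in a compact set, so two of
them with i.+1 < j are close to each other; the multiples of u_i - u_j cancel
in the combination with weights mu and mu'. *)
Lemma not_both_compact (R : realType) (X : completeNormedModType R)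
    (Y : set X) (T T' : X -> X) (u : nat -> X) (l l' mu mu' g : R) (K : nat) :
  (forall i, Y (u i)) -> (forall i, `|u i| <= 1) ->
  mu * l + mu' * l' = 0 -> 0 < g ->
  (forall i j, (K <= i)%N -> (i.+1 < j)%N ->
    g <= `|mu *: (T (u i) - T (u j)) + mu' *: (T' (u i) - T' (u j))|) ->
  compact_operator_on Y (fun y => T y - l *: y) ->
  compact_operator_on Y (fun y => T' y - l' *: y) -> False.
Proof.
move=> Yu u1 mul g0 sep; rewrite /compact_operator_on !precompactE => c c'.
pose f i := T (u i) - l *: u i; pose f' i := T' (u i) - l' *: u i.
pose ff i := (f i, f' i).
have ffc : (ff @ \oo) (closure [set T y - l *: y | y in [set y | Y y /\ `|y| <= 1]] `*`
    closure [set T' y - l' *: y | y in [set y | Y y /\ `|y| <= 1]]).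
  by exists 0%N => // i _; split; apply: subset_closure; exists (u i).
have [[q q'] [_ clq]] := @compact_setX _ _ _ _ c c' (ff @ \oo) _ ffc.
pose M := `|mu| + `|mu'| + 1.
have M0 : 0 < M by rewrite ltr_wpDl// addr_ge0.
pose e := g / (4 * M).
have e0 : 0 < e by rewrite divr_gt0// mulr_gt0.
have near n : exists2 i, (n <= i)%N & `|q - f i| < e /\ `|q' - f' i| < e.
  have [||_ [[i ni <-] [h h']]] := clq [set ff i | i in [set i | (n <= i)%N]]
    [set w | `|q - w.1| < e /\ `|q' - w.2| < e] _ _.
  - by exists n => // i ni; exists i.
  - exists (ball q e, ball q' e) => /=.
      by split; exact: nbhsx_ballx.
    by move=> [w w'] /= []; rewrite -!ball_normE.
  - by exists i.
have [i Ki [qi qi']] := near K; have [j ij [qj qj']] := near i.+2.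
have := sep i j Ki ij.
have -> : mu *: (T (u i) - T (u j)) + mu' *: (T' (u i) - T' (u j)) =
    mu *: (f i - f j) + mu' *: (f' i - f' j).
  have E (t s t' s' : X) (k : R) : t - k *: s - (t' - k *: s') =
      (t - t') - k *: (s - s').
    by rewrite scalerBr !opprB [k *: s' - t']addrC addrACA [- (k *: s) + _]addrC.
  rewrite /f /f' !E; set dT := T _ - _; set dT' := T' _ - _; set du := u i - _.
  rewrite [mu *: (_ - l *: _)]scalerBr [mu' *: (_ - l' *: _)]scalerBr !scalerA.
  by rewrite addrACA -opprD -scalerDl mul scale0r subr0.
apply/negP; rewrite -ltNge.
have dist (w a b : X) : `|w - a| < e -> `|w - b| < e -> `|a - b| < 2 * e.
  move=> wa wb; have -> : a - b = (w - b) - (w - a).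
    by rewrite opprB [RHS]addrC addrA subrK.
  by apply: (le_lt_trans (ler_normB _ _)); lra.
have d1 := dist _ _ _ qi qj; have d2 := dist _ _ _ qi' qj'.
apply: (le_lt_trans (ler_normD _ _)); rewrite !normrZ.
have h1 : `|mu| * `|f i - f j| <= `|mu| * (2 * e) by rewrite ler_wpM2l// ltW.
have h2 : `|mu'| * `|f' i - f' j| <= `|mu'| * (2 * e) by rewrite ler_wpM2l// ltW.
have h3 : M * (4 * e) = g.
  by rewrite /e; field; rewrite lt0r_neq0.
have h4 : M * (4 * e) = 2 * (`|mu| * (2 * e) + `|mu'| * (2 * e)) + 4 * e.
  by rewrite /M; lra.
have := normr_ge0 mu; have := normr_ge0 mu'.
have := mulr_ge0 (normr_ge0 mu) (ltW e0);
  have := mulr_ge0 (normr_ge0 mu') (ltW e0).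
lra.
Qed.


Theorem theorem5p2 (R : realType) (X E F : completeNormedModType R)
    (x z : nat -> X) (xt : nat -> E) (zt : nat -> F)
    (x_normalized : normalized x) (x_weakly_null : weakly_null x)
    (x_basic : basic_sequence x)
    (z_normalized : normalized z) (z_weakly_null : weakly_null z)
    (z_basic : basic_sequence z)
    (x_spreading : spreading_model x xt)
    (xt_not_l1 : ~ equivalent_lp_basis 1%:E xt)
    (z_spreading : spreading_model z zt)
    (zt_krivine : krivine_set zt 1%:E) :
  exists (Y : set X) (T : X -> X),
    [/\ closed_subspace Y, bounded_linear_on Y T &
      forall lambda : R,
        ~ compact_operator_on Y (fun y => T y - lambda *: y)].
Proof.
have [u [p [C [u1 pinc dom]]]] := sparse_subsequence_dominated x_normalized x_weakly_null
  x_spreading xt_not_l1 z_weakly_null z_spreading zt_krivine.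
have [T [Tl Tu]] : exists T : X -> X,
    bounded_linear_on (closure (seq_span u)) T /\ forall i, T (u i) = x (p i).
  apply: (@extend_operator _ _ u (fun i => x (p i)) C) => n a.
  by have := dom 0%N n a; under eq_bigr do rewrite addn0.
have [T' [T'l T'u]] : exists T : X -> X,
    bounded_linear_on (closure (seq_span u)) T /\ forall i, T (u i) = x (p i.+1).
  apply: (@extend_operator _ _ u (fun i => x (p i.+1)) C) => n a.
  by have := dom 1%N n a; under eq_bigr do rewrite addn1.
set Y := closure (seq_span u) in Tl T'l.
have Yc : closed_subspace Y by exact: closure_span_submod.
have Yu i : Y (u i) by exact: closure_span_mem.
apply: contrapT => nYT.
have [l cl] : exists l : R, compact_operator_on Y (fun y => T y - l *: y).
  by apply: contrapT => nl; apply: nYT; exists Y, T; split=> // l cl;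
    apply: nl; exists l.
have [l' cl'] : exists l' : R, compact_operator_on Y (fun y => T' y - l' *: y).
  by apply: contrapT => nl; apply: nYT; exists Y, T'; split=> // l' cl';
    apply: nl; exists l'.
have [mu [mu' [mul mu0]]] : exists mu mu' : R,
    mu * l + mu' * l' = 0 /\ (mu != 0 \/ mu' != 0).
  have [l0|l0] := eqVneq l 0.
    by exists 1, 0; rewrite l0 mulr0 mul0r addr0; split=> //; left;
      exact: oner_neq0.
  exists l', (- l); split; first by rewrite mulNr mulrC subrr.
  by right; rewrite oppr_eq0.
have [g [g0 [K sep]]] := spreading_separated x_spreading pinc mu0.
apply: (@not_both_compact _ _ Y T T' u l l' mu mu' g K) => // i j Ki ij.
rewrite !Tu !T'u; exact: (sep i j Ki ij).
Qed.
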